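(* Let $I \subset R = K[\mathcal{A}]$ be a square-free monomial ideal and suppose that its labeled hypergraph $\mathcal{H}(I) = (V, X, E, \mathcal{E})$ has isolated simple edges. Then \[\mathrm{reg}(R/I) = |X| - |V| + \sum_{\substack{F \in \mathcal{E}\\ F \text{ simple}}} (|F| - 1).\]
   Context: $K$ is a field, $\mathcal{A}$ is a finite set of symbols regarded as variables, and $R = K[\mathcal{A}]$ is the polynomial ring with the standard grading (every variable has degree one). For a finitely generated graded $R$-module $M$ with graded Betti numbers $\beta_{ij}(M)$ (so that the $i$th module of the minimal graded free resolution is $\bigoplus_j R(-j)^{\beta_{ij}(M)}$), $\mathrm{reg}(M) = \max\{j-i : \beta_{ij}(M)\neq 0 \text{ for some } i\}$. Labeled hypergraph of an ideal: let $I\subset R$ be a square-free monomial ideal with minimal monomial generating set $\{f_1,\ldots,f_\mu\}$. Its labeled hypergraph is $\mathcal{H}(I) = (V,X,E,\mathcal{E})$ where $V = \{1,\ldots,\mu\}$; $E$ is the function from $\mathcal{A}$ to the power set of $V$ given by $E_a = E(a) = \{j : a \text{ divides } f_j\}$; $X = \{a\in\mathcal{A} : E_a\neq\emptyset\}$; and $\mathcal{E} = \mathrm{Im}(E)$ is the set of (distinct) edges. A vertex $v\in V$ is closed if $\{v\}\in\mathcal{E}$, and open otherwise. $|F|$ denotes the number of vertices in an edge $F$. An edge $F\in\mathcal{E}$ is simple if $|F|\ge 2$ and $F$ has no proper subedges besides $\emptyset$ (i.e. no nonempty $G\in\mathcal{E}$ with $G\subsetneq F$). The hypergraph has isolated simple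 edges if every open vertex is contained in exactly one simple edge. *)

(* Defs.v *)
From HB Require Import structures.
From mathcomp Require Import all_boot all_order all_algebra.
From mathcomp Require Import mpoly.

Set Implicit Arguments.
Unset Strict Implicit.
Unset Printing Implicit Defensive.

Import GRing.Theory Num.Theory.
Local Open Scope ring_scope.

Section MonomialIdeals.
Variables (K : fieldType) (n : nat).
Implicit Types I : {mpoly K[n]} -> Prop.

Definition monomial_span (mu : nat) (f : 'I_mu -> 'X_{1..n}) (S : {set 'I_mu})
    (p : {mpoly K[n]}) : Prop :=
  exists c : 'I_mu -> {mpoly K[n]}, p = \sum_(i in S) c i * 'X_[f i].

Definition generates (mu : nat) (f : 'I_mu -> 'X_{1..n}) (S : {set 'I_mu})
    I : Prop :=
  forall p, I p <-> monomial_span f S p.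

Definition squarefree_monomial (m : 'X_{1..n}) : Prop :=
  forall a : 'I_n, (m a <= 1)%N.

Definition squarefree_monomial_ideal I : Prop :=
  exists (k : nat) (g : 'I_k -> 'X_{1..n}),
    (forall i, squarefree_monomial (g i)) /\ generates g [set: 'I_k] I.

(* The second clause forces f to be injective: a repeated generator could be
   dropped. *)
Definition minimal_monomial_generators I (mu : nat) (f : 'I_mu -> 'X_{1..n})
    : Prop :=
  generates f [set: 'I_mu] I /\
  (forall S : {set 'I_mu}, generates f S I -> S = [set: 'I_mu]).

End MonomialIdeals.

Section LabeledHypergraph.
Variables (A V : finType) (E : A -> {set V}).

Definition labels : {set A} := [set a | E a != set0].

Definition edges : {set {set V}} := [set E a | a : A].

Definition closed_vertex (v : V) : bool := [set v] \in edges.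

Definition open_vertex (v : V) : bool := ~~ closed_vertex v.

Definition simple_edge (F : {set V}) : bool :=
  [&& F \in edges, (2 <= #|F|)%N &
      [forall G in edges, (G != set0) ==> ~~ (G \proper F)]].

Definition isolated_simple_edges : Prop :=
  forall v : V, open_vertex v ->
    exists! F : {set V}, simple_edge F /\ v \in F.

End LabeledHypergraph.

Definition hypergraph_edge (n mu : nat) (f : 'I_mu -> 'X_{1..n}) (a : 'I_n)
    : {set 'I_mu} :=
  [set j | (U_(a) <= f j)%MM].

(* The i-th module is the direct sum of the R(- shift k) for k < rank i; its
   elements are row vectors, on which the differentials act on the right.  The
   last field says that the differentials preserve degrees.  Complexes of finite
   length have rank 0 from some point on. *)
Record graded_free_sequence (K : fieldType) (n : nat) := GradedFreeSequence {
  rank : nat -> nat;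
  shift : forall i, 'I_(rank i) -> int;
  diff : forall i, 'M[{mpoly K[n]}]_(rank i.+1, rank i);
  diff_graded : forall i k l m, m \in msupp (diff i k l) ->
    shift k = shift l + (mdeg m)%:Z
}.

Section Regularity.
Variables (K : fieldType) (n : nat).
Implicit Types (I : {mpoly K[n]} -> Prop) (F : graded_free_sequence K n).

(* The augmentation F_0 -> R/I sends the k-th basis vector to the class of the
   homogeneous polynomial [e k 0]. *)
Definition resolves I F (e : 'cV[{mpoly K[n]}]_(rank F 0%N)) : Prop :=
  [/\ (forall k m, m \in msupp (e k 0) -> shift k = (mdeg m)%:Z),
      (forall p : {mpoly K[n]}, exists v : 'rV_(rank F 0%N),
         I (p - (v *m e) 0 0)),
      (forall v : 'rV_(rank F 0%N),
         I ((v *m e) 0 0) <-> exists w, v = w *m diff F 0%N)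
    & (forall i (v : 'rV_(rank F i.+1)),
         v *m diff F i = 0 <-> exists w, v = w *m diff F i.+1)].

(* All entries lie in the ideal generated by the variables. *)
Definition minimal F : Prop := forall i k l, (diff F i k l)@_0%MM = 0.

Definition minimal_graded_free_resolution I F : Prop :=
  (exists e : 'cV_(rank F 0%N), @resolves I F e) /\ minimal F.

Definition graded_betti F (i : nat) (j : int) : nat :=
  #|[set k : 'I_(rank F i) | shift k == j]|.

Definition is_maximum (S : int -> Prop) (r : int) : Prop :=
  S r /\ forall s, S s -> s <= r.

(* [is_regularity I r] means reg (R/I) = r.  The minimal graded free resolution
   exists and is unique up to isomorphism; rather than choosing one, we ask that
   there be one and that all of them yield the value r. *)
Definition is_regularity I (r : int) : Prop :=
  (exists F, minimal_graded_free_resolution I F) /\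
  (forall F, minimal_graded_free_resolution I F ->
     is_maximum
       (fun s => exists i j, graded_betti F i j <> 0%N /\ s = j - i%:Z) r).

End Regularity.

(* Main.v *)
Require Import Defs.
From HB Require Import structures.
From mathcomp Require Import all_boot all_order all_algebra.
From mathcomp Require Import mpoly ring.

(** Let [M] be the set of minimal nonempty edges of the hypergraph: the singletons
    of the closed vertices and the simple edges.  With isolated simple edges, [M]
    is a partition of the vertices, so the sum over the simple edges equals
    [#|V| - #|M|] and the claim becomes [reg (R/I) = #|X| - #|M|]
    ([minimal_edges_partition], [sum_simple_edges]).

    The Taylor complex of the generators resolves [R/I].  It has a basis element
    for each set [T] of vertices, in homological degree [#|T|] and of internal
    degree the degree of the least common multiple of the generators in [T],
    which is the number of labels [a] whose edge [E a] meets [T].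

    Upper bound.  The disjoint edges of [M] either meet [T], which costs a vertex
    of [T] each, or miss [T], which costs a label each; hence every basis element
    satisfies [degree - #|T| <= #|X| - #|M|] ([minimal_edges_bound]).  The shifts
    of a minimal resolution occur among those of any other resolution
    ([minimal_shift]).

    Lower bound.  A set that meets every edge of [M] exactly once gives a basis
    element in homological degree [#|M|] and internal degree [#|X|].  Its
    boundary vanishes modulo the variables.  The function [top_cocycle], which is
    [1] on the sets of this kind, vanishes on all boundaries modulo the variables,
    once the Taylor signs are taken for an order of the vertices in which the
    edges in [M] are intervals ([top_cocycle_boundary]).  So this homology class
    survives in every resolution ([surviving_shift]).

    Both transfers rest on [resolution_comparison]: two graded resolutions are
    related by graded maps that are inverse to each other up to homotopy, and
    null-homotopic endomorphisms of a minimal complex vanish modulo the variables.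

    A minimal resolution exists because the Taylor complex can be reduced by
    Gaussian elimination on unit entries.  All complexes involved are multigraded
    with at most one monomial in each entry, so they are encoded by scalar
    matrices ([is_frame]), and exactness is a condition on finite-dimensional
    vector spaces, one for each multidegree. *)

Set Implicit Arguments.
Unset Strict Implicit.
Unset Printing Implicit Defensive.

Import GRing.Theory Num.Theory.
Local Open Scope ring_scope.

(** * Supports of polynomials and monomial ideals *)

Section Supports.
Variables (K : fieldType) (n : nat).
Implicit Types (m : 'X_{1..n}) (p q : {mpoly K[n]}) (I : {mpoly K[n]} -> Prop).

Lemma mnm_le_antisym m1 m2 : (m1 <= m2)%MM -> (m2 <= m1)%MM -> m1 = m2.
Proof.
move=> /mnm_lepP h1 /mnm_lepP h2; apply/mnmP => i; apply/eqP.
by rewrite eqn_leq h1 h2.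
Qed.

Lemma mnm_le0 m : (m <= 0)%MM -> m = 0%MM.
Proof.
by move=> h; apply: (mnm_le_antisym h); apply/mnm_lepP => i; rewrite mnm0E.
Qed.

(** Stated without truncated subtraction, so that it applies whether or not
    [m1] divides [m]. *)
Lemma mcoeffMX_div p m1 m :
  (p * 'X_[m1])@_m = p@_(m - m1) *+ (m1 <= m)%MM.
Proof.
case: (boolP (m1 <= m)%MM) => [le_m|nle_m].
  by rewrite -{1}(submK le_m) addmC mcoeffMX.
rewrite mulr0n; apply: memN_msupp_eq0; apply: contraNN nle_m => mM.
move: mM; rewrite (perm_mem (msuppMX _ _)) => /mapP[m2 _ ->].
exact: lem_addr.
Qed.

(** Selecting monomials by a predicate rather than by a natural degree also makes
    sense of homogeneous components of negative degree, which are zero. *)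
Definition support_part (P : pred 'X_{1..n}) p : {mpoly K[n]} :=
  \sum_(m <- msupp p | P m) p@_m *: 'X_[m].

Lemma mcoeff_support_part P p m : (support_part P p)@_m = p@_m *+ P m.
Proof.
rewrite raddf_sum /= -big_filter.
under eq_bigr do rewrite mcoeffZ mcoeffX.
case: (boolP (m \in [seq m' <- msupp p | P m'])) => [mP|nmP].
  rewrite (bigD1_seq m) //= ?filter_uniq ?msupp_uniq // eqxx mulr1.
  rewrite big1 ?addr0 => [|m' ne]; last by rewrite (negPf ne) mulr0.
  by move: mP; rewrite mem_filter => /andP[-> _].
rewrite big_seq big1 => [|m' m'P].
  move: nmP; rewrite mem_filter negb_and => /orP[/negPf->|/memN_msupp_eq0->] //.
  by rewrite mul0rn.
by case: eqP nmP m'P => [<- /negPf->//|]; rewrite mulr0.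
Qed.

Lemma support_part_id (P : pred 'X_{1..n}) p :
  {in msupp p, forall m, P m} -> support_part P p = p.
Proof.
move=> pP; apply/mpolyP => m; rewrite mcoeff_support_part.
by case: (boolP (m \in msupp p)) => [/pP->//|/memN_msupp_eq0->]; rewrite mul0rn.
Qed.

Lemma mem_support_part P p m : m \in msupp (support_part P p) ->
  P m /\ m \in msupp p.
Proof.
by rewrite !mcoeff_msupp mcoeff_support_part; case: (P m); rewrite ?eqxx.
Qed.

Fact support_part_is_additive P : additive (support_part P).
Proof.
move=> p q; apply/mpolyP => m.
by rewrite mcoeffB !mcoeff_support_part mcoeffB mulrnBl.
Qed.
HB.instance Definition _ P := GRing.isAdditive.Build {mpoly K[n]} {mpoly K[n]}
  (support_part P) (support_part_is_additive P).

(** Homogeneous components of a product with a homogeneous [q] are products with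
    homogeneous components: take for [P] and [Q] the monomials of degree [d] and
    [d + deg q]. *)
Lemma support_partM P Q p q :
  (forall m m', m' \in msupp q -> P m = Q (m + m')%MM) ->
  support_part P p * q = support_part Q (p * q).
Proof.
move=> PQ; rewrite [in LHS](mpolyE q) [in RHS](mpolyE q) !mulr_sumr raddf_sum /=.
rewrite [LHS]big_seq [RHS]big_seq; apply: eq_bigr => m' m'q.
apply/mpolyP => m; rewrite mcoeff_support_part -!scalerAr !mcoeffZ.
rewrite !mcoeffMX_div mcoeff_support_part.
case: (boolP (m' <= m)%MM) => [le_m|_]; last by rewrite !mulr0n mulr0 mul0rn.
by rewrite (PQ _ _ m'q) submK // !mulr1n mulrnAr.
Qed.

Section MonomialSpan.
Variables (mu : nat) (f : 'I_mu -> 'X_{1..n}) (S : {set 'I_mu}).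

Lemma monomial_spanD p q :
  monomial_span f S p -> monomial_span f S q -> monomial_span f S (p + q).
Proof.
move=> [c ->] [d ->]; exists (fun i => c i + d i).
by rewrite -big_split /=; apply: eq_bigr => i _; rewrite mulrDl.
Qed.

(** A polynomial lies in a monomial ideal as soon as each of its monomials does, so
    that membership is a condition on the support alone. *)
Lemma monomial_spanP p : monomial_span f S p <->
  {in msupp p, forall m, exists2 i, i \in S & (f i <= m)%MM}.
Proof.
split=> [[c ->] m|supp_p].
  rewrite mcoeff_msupp raddf_sum /= => nz.
  have [i /andP[iS le_i]|none] := pickP (fun i => (i \in S) && (f i <= m)%MM).
    by exists i.
  case/eqP: nz; apply: big1 => i iS; rewrite mcoeffMX_div.
  by move: (none i); rewrite iS /= => ->; rewrite mulr0n.
rewrite [p]mpolyE big_seq; apply: big_ind => [||m /supp_p[i iS le_i]].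
- by exists (fun=> 0); rewrite big1 // => i _; rewrite mul0r.
- exact: monomial_spanD.
exists (fun j => if j == i then p@_m *: 'X_[m - f i] else 0).
rewrite (bigD1 i) //= eqxx big1 ?addr0 => [|j /andP[_ /negPf->]]; last first.
  by rewrite mul0r.
by rewrite -scalerAl -mpolyXD submK.
Qed.

End MonomialSpan.

Section GeneratedIdeal.
Variables (mu : nat) (f : 'I_mu -> 'X_{1..n}) (S : {set 'I_mu}).
Variable (I : {mpoly K[n]} -> Prop).
Hypothesis genI : generates f S I.

Lemma generated_msuppP p : I p <->
  {in msupp p, forall m, exists2 i, i \in S & (f i <= m)%MM}.
Proof. by split=> [/genI/monomial_spanP|/monomial_spanP/genI]. Qed.

Lemma generatedX m : I 'X_[m] <-> exists2 i, i \in S & (f i <= m)%MM.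
Proof.
rewrite generated_msuppP msuppX; split=> [|H m']; first by apply; rewrite inE.
by rewrite inE => /eqP->.
Qed.

Lemma generated0 : I 0.
Proof. by apply/generated_msuppP => m; rewrite mcoeff_msupp mcoeff0 eqxx. Qed.

Lemma generatedD p q : I p -> I q -> I (p + q).
Proof.
move=> /generated_msuppP Ip /generated_msuppP Iq; apply/generated_msuppP => m.
by move/msuppD_le; rewrite mem_cat => /orP[/Ip|/Iq].
Qed.

Lemma generatedMl c p : I p -> I (c * p).
Proof.
move=> /generated_msuppP Ip; apply/generated_msuppP => m /msuppM_le.
move=> /allpairsP[[m1 m2] /= [_ /Ip[i iS le_i] ->]]; exists i => //.
exact: lepm_trans le_i (lem_addl _ _).
Qed.

Lemma generatedB p q : I p -> I q -> I (p - q).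
Proof.
by move=> Ip Iq; apply: generatedD => //; rewrite -mulN1r; apply: generatedMl.
Qed.

Lemma generated_sum (T : finType) (F : T -> {mpoly K[n]}) :
  (forall t, I (F t)) -> I (\sum_t F t).
Proof.
by move=> IF; apply: big_ind => //; [apply: generated0 | apply: generatedD].
Qed.

Lemma generated_support_part P p : I p -> I (support_part P p).
Proof.
move=> /generated_msuppP Ip; apply/generated_msuppP => m.
by case/mem_support_part => _ /Ip.
Qed.

End GeneratedIdeal.

End Supports.

(** * Comparison of two graded free resolutions *)

Section GradedMatrices.
Variables (K : fieldType) (n : nat).
Local Notation R := {mpoly K[n]}.

Definition graded_mx p q (s : 'I_p -> int) (t : 'I_q -> int)
    (M : 'M[R]_(p, q)) : Prop :=
  forall k l m, m \in msupp (M k l) -> s k = t l + (mdeg m)%:Z.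

(** The degree-preserving part of a matrix.  Taking it turns any lift through a
    graded differential into a graded lift. *)
Definition graded_part p q (s : 'I_p -> int) (t : 'I_q -> int)
    (M : 'M[R]_(p, q)) : 'M[R]_(p, q) :=
  \matrix_(k, l) support_part [pred m | s k == t l + (mdeg m)%:Z] (M k l).

Lemma graded_part_graded p q s t (M : 'M[R]_(p, q)) :
  graded_mx s t (graded_part s t M).
Proof. by move=> k l m; rewrite mxE => /mem_support_part[/eqP]. Qed.

Lemma graded_part_id p q s t (M : 'M[R]_(p, q)) :
  graded_mx s t M -> graded_part s t M = M.
Proof.
move=> gM; apply/matrixP => k l; rewrite mxE support_part_id // => m mM /=.
by apply/eqP/gM.
Qed.

Lemma graded_part_mul p q r s t u (M : 'M[R]_(p, q)) (D : 'M[R]_(q, r)) :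
  graded_mx t u D -> graded_part s t M *m D = graded_part s u (M *m D).
Proof.
move=> gD; apply/matrixP => k j; rewrite !mxE raddf_sum /=.
apply: eq_bigr => l _; rewrite mxE; apply: support_partM => m m' /gD /= ->.
by rewrite mdegD PoszD -addrA (addrC (mdeg m)%:Z).
Qed.

Lemma graded_mulmx p q r s t u (M : 'M[R]_(p, q)) (D : 'M[R]_(q, r)) :
  graded_mx s t M -> graded_mx t u D -> graded_mx s u (M *m D).
Proof.
move=> gM gD; rewrite -(graded_part_id gM) (graded_part_mul _ _ gD).
exact: graded_part_graded.
Qed.

(** A unit entry of a graded matrix forces equal degrees; this is what turns
    identities between constant terms into statements about shifts. *)
Lemma graded_mx_const p q s t (M : 'M[R]_(p, q)) k l :
  graded_mx s t M -> (M k l)@_0 != 0 -> s k = t l.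
Proof. by rewrite -mcoeff_msupp => gM /gM->; rewrite mdeg0 addr0. Qed.

End GradedMatrices.

Section Resolution.
Variables (K : fieldType) (n mu : nat) (f : 'I_mu -> 'X_{1..n}).
Variables (S : {set 'I_mu}) (I : {mpoly K[n]} -> Prop).
Hypothesis genI : generates f S I.
Variables (F : graded_free_sequence K n) (e : 'cV[{mpoly K[n]}]_(rank F 0)).
Hypothesis resF : resolves I e.
Local Notation R := {mpoly K[n]}.

(** The rows of [M] are cycles of the resolution augmented by [R / I], so that
    degree [0] can be treated like the others. *)
Definition cycle_mx p i : 'M[R]_(p, rank F i) -> Prop :=
  if i is i'.+1 then fun M => M *m diff F i' = 0
  else fun M => forall k, I ((M *m e) k 0).

Definition boundary_mx p i (M : 'M[R]_(p, rank F i)) : Prop :=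
  exists W, M = W *m diff F i.

Lemma row_boundary_mx p i (M : 'M[R]_(p, rank F i)) :
  (forall k, boundary_mx (row k M)) -> boundary_mx M.
Proof.
move=> /fin_all_exists[w wE]; exists (\matrix_k w k).
by apply/row_matrixP => k; rewrite wE row_mul rowK.
Qed.

Lemma cycle_boundary p i (M : 'M[R]_(p, rank F i)) :
  cycle_mx M -> boundary_mx M.
Proof.
case: resF => _ _ exact0 exactS; move=> cycM; apply: row_boundary_mx => k.
case: i M cycM => [|i] M /= cycM.
  by apply/exact0; rewrite -row_mul mxE.
by apply/exactS; rewrite -row_mul cycM row0.
Qed.

Lemma boundary_cycle p i (W : 'M[R]_(p, rank F i.+1)) :
  cycle_mx (W *m diff F i).
Proof.
case: resF => _ _ exact0 exactS.
case: i W => [|i] W /= => [k|].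
  have -> : (W *m diff F 0 *m e) k 0 = (row k (W *m diff F 0) *m e) 0 0.
    by rewrite -row_mul [RHS]mxE.
  by apply/exact0; exists (row k W); rewrite row_mul.
apply/row_matrixP => k; rewrite row0 row_mul; apply/exactS.
by exists (row k W); rewrite row_mul.
Qed.

Lemma diff_diff i : diff F i.+1 *m diff F i = 0.
Proof. by have := boundary_cycle (i := i.+1) 1%:M; rewrite mul1mx. Qed.

Lemma augmentation_graded :
  graded_mx (@shift _ _ F 0) (fun=> 0) e.
Proof. by case: resF => gF _ _ _ k l m; rewrite ord1 add0r => /gF. Qed.

Lemma graded_cycle_boundary p (s : 'I_p -> int) i (M : 'M[R]_(p, rank F i)) :
    graded_mx s (@shift _ _ F i) M -> cycle_mx M ->
  exists2 W, graded_mx s (@shift _ _ F i.+1) W & M = W *m diff F i.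
Proof.
move=> gM /cycle_boundary[W WE].
exists (graded_part s (@shift _ _ F i.+1) W); first exact: graded_part_graded.
rewrite (graded_part_mul _ _ (@diff_graded _ _ F i)) -WE.
by rewrite graded_part_id.
Qed.

Lemma graded_augmentation_lift p (s : 'I_p -> int) (M : 'cV[R]_p) :
    graded_mx s (fun=> 0) M ->
  exists2 W, graded_mx s (@shift _ _ F 0) W & forall k, I ((M - W *m e) k 0).
Proof.
move=> gM; case: resF => _ surj _ _.
have /fin_all_exists[w wI] k :
    exists v : 'rV_(rank F 0), I (M k 0 - (v *m e) 0 0) by exact: surj.
exists (graded_part s (@shift _ _ F 0) (\matrix_k w k)) => [|k].
  exact: graded_part_graded.
rewrite (graded_part_mul _ _ augmentation_graded).
rewrite -[in X in X - _](graded_part_id gM).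
rewrite !mxE -raddfB /=; apply: (generated_support_part genI).
have := wI k; congr (I (_ - _)); rewrite !mxE.
by apply: eq_bigr => l _; rewrite mxE.
Qed.

(** The term [diff F (i - 1) *m h] of a homotopy in degree [i], which is absent
    when [i] is [0]. *)
Definition from_diff p i : 'M[R]_(rank F i, p) -> Prop :=
  if i is i'.+1 then fun N => exists h, N = diff F i' *m h else fun N => N = 0.

Lemma diff_from_diff p i (N : 'M[R]_(rank F i, p)) :
  from_diff N -> diff F i *m N = 0.
Proof.
case: i N => [|i] N /= => [->|[h ->]]; first by rewrite mulmx0.
by rewrite mulmxA diff_diff mul0mx.
Qed.

End Resolution.

Section Comparison.
Variables (K : fieldType) (n mu : nat) (f : 'I_mu -> 'X_{1..n}).
Variables (S : {set 'I_mu}) (I : {mpoly K[n]} -> Prop).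
Hypothesis genI : generates f S I.
Implicit Types F G : graded_free_sequence K n.
Local Notation R := {mpoly K[n]}.

(** The last two terms of the sum form the boundary of a homotopy with components
    [h] and the one hidden in [N]. *)
Definition homotopic_id F i (phi : 'M[R]_(rank F i)) : Prop :=
  exists h N, from_diff N /\ phi = 1%:M + h *m diff F i + N.

(** By the lifting equations, [phi' *m psi' - 1 - diff F i *m h] consists of
    cycles, hence of boundaries; the homotopy [h] of degree [i] becomes the hidden
    term in degree [i + 1]. *)
Lemma homotopic_id_step F G (eF : 'cV_(rank F 0)) i phi psi phi' psi' :
    resolves I eF -> @homotopic_id F i (phi *m psi) ->
    diff F i *m phi = phi' *m diff G i -> diff G i *m psi = psi' *m diff F i ->
  @homotopic_id F i.+1 (phi' *m psi').
Proof.
move=> resF [h [N [dN phipsi]]] phi'E psi'E.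
have : cycle_mx I eF (phi' *m psi' - 1%:M - diff F i *m h).
  have comp : phi' *m psi' *m diff F i = diff F i *m (phi *m psi).
    by rewrite -mulmxA -psi'E !mulmxA phi'E.
  rewrite /= !mulmxBl comp phipsi !mulmxDr (diff_from_diff resF dN).
  by rewrite mulmx1 mul1mx addr0 mulmxA -addrA -opprD subrr.
move=> /(cycle_boundary resF)[h' h'E].
exists h', (diff F i *m h); split; first by exists h.
by rewrite -h'E addrAC -(addrA (phi' *m _)) -opprD addrC subrK.
Qed.

(** The comparison theorem for resolutions.  Existence is asserted
    degree by degree, so that a plain induction gives degree [i + 1] from degree
    [i] without choosing whole chain maps. *)
Lemma resolution_comparison F G
    (eF : 'cV_(rank F 0)) (eG : 'cV_(rank G 0)) i :
    resolves I eF -> resolves I eG ->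
  exists (phi : 'M[R]_(rank F i, rank G i)) (psi : 'M[R]_(rank G i, rank F i)),
    [/\ graded_mx (@shift _ _ F i) (@shift _ _ G i) phi,
        graded_mx (@shift _ _ G i) (@shift _ _ F i) psi,
        homotopic_id (phi *m psi) & homotopic_id (psi *m phi)].
Proof.
move=> resF resG.
(* That [diff F i *m phi] consists of cycles of [G] is what allows the next
   lift, so it is carried along the induction. *)
suff [phi [psi [? ? ? [? _ _]]]] : exists phi psi,
    [/\ graded_mx (@shift _ _ F i) (@shift _ _ G i) phi,
        graded_mx (@shift _ _ G i) (@shift _ _ F i) psi,
        homotopic_id (phi *m psi) &
    [/\ homotopic_id (psi *m phi),
        cycle_mx I eG (diff F i *m phi) & cycle_mx I eF (diff G i *m psi)]].
  by exists phi, psi.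
have lift0 (F' G' : graded_free_sequence K n) (eF' : 'cV_(rank F' 0))
    (eG' : 'cV_(rank G' 0)) : resolves I eF' -> resolves I eG' ->
  exists2 phi, graded_mx (@shift _ _ F' 0) (@shift _ _ G' 0) phi &
    (forall k, I ((eF' - phi *m eG') k 0)) /\ cycle_mx I eG' (diff F' 0 *m phi).
  move=> resF' resG'.
  have [phi gphi phiE] :=
    graded_augmentation_lift genI resG' (augmentation_graded resF').
  exists phi => //; split=> // k.
  have -> : diff F' 0 *m phi *m eG' =
      1%:M *m diff F' 0 *m eF' - diff F' 0 *m (eF' - phi *m eG').
    by rewrite mul1mx mulmxBr mulmxA opprB addrC subrK.
  rewrite mxE [X in _ + X]mxE; apply: (generatedB genI).
    exact: (@boundary_cycle _ _ _ _ _ resF' _ 0 1%:M).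
  by rewrite mxE; apply: (generated_sum genI) => l; apply: (generatedMl genI).
have hid0 (F' G' : graded_free_sequence K n) (eF' : 'cV_(rank F' 0))
    (eG' : 'cV_(rank G' 0)) phi psi : resolves I eF' ->
    (forall k, I ((eF' - phi *m eG') k 0)) ->
    (forall k, I ((eG' - psi *m eF') k 0)) ->
  @homotopic_id F' 0 (phi *m psi).
  move=> resF' phiE psiE.
  have : cycle_mx I eF' (1%:M - phi *m psi).
    move=> k; rewrite mulmxBl mul1mx -mulmxA.
    have -> : eF' - phi *m (psi *m eF') =
        (eF' - phi *m eG') + phi *m (eG' - psi *m eF').
      by rewrite mulmxBr addrA subrK.
    rewrite mxE; apply: (generatedD genI) => //.
    by rewrite mxE; apply: (generated_sum genI) => l; apply: (generatedMl genI).
  move=> /(cycle_boundary resF')[h hE]; exists (- h), 0; split=> //.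
  by rewrite addr0 mulNmx -hE opprB addrC subrK.
elim: i => [|i [phi [psi [gphi gpsi hF [hG cphi cpsi]]]]].
  have [phi gphi [phiE cphi]] := lift0 _ _ _ _ resF resG.
  have [psi gpsi [psiE cpsi]] := lift0 _ _ _ _ resG resF.
  exists phi, psi; split=> //; first exact: hid0 resF phiE psiE.
  by split=> //; apply: hid0 resG psiE phiE.
have gdF := @diff_graded _ _ F i; have gdG := @diff_graded _ _ G i.
have [phi' gphi' phi'E] :=
  graded_cycle_boundary resG (graded_mulmx gdF gphi) cphi.
have [psi' gpsi' psi'E] :=
  graded_cycle_boundary resF (graded_mulmx gdG gpsi) cpsi.
exists phi', psi'; split=> //; first exact: homotopic_id_step resF hF phi'E psi'E.
split; first exact: homotopic_id_step resG hG psi'E phi'E.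
- rewrite /= -mulmxA -phi'E mulmxA.
  by rewrite (diff_diff resF) mul0mx.
- rewrite /= -mulmxA -psi'E mulmxA.
  by rewrite (diff_diff resG) mul0mx.
Qed.

Local Notation constant_part := (map_mx (mcoeff 0%MM)).

Lemma minimal_constant_part F i p (N : 'M[R]_(rank F i, p)) :
  minimal F -> from_diff N -> constant_part N = 0.
Proof.
move=> minF; case: i N => [|i] N /= => [->|[h ->]]; first exact: map_mx0.
suff d0 : constant_part (diff F i) = 0 by rewrite map_mxM d0 mul0mx.
by apply/matrixP => k l; rewrite !mxE minF.
Qed.

(** Null-homotopic endomorphisms of the minimal complex [F] vanish modulo the
    variables, so the composite [F -> G -> F] is the identity there; each basis
    element of [F] then has a unit coefficient on some basis element of [G] of the
    same degree. *)
Lemma minimal_shift F G (eF : 'cV_(rank F 0)) (eG : 'cV_(rank G 0)) i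
    (k : 'I_(rank F i)) :
    minimal F -> resolves I eF -> resolves I eG ->
  exists l : 'I_(rank G i), shift k = shift l.
Proof.
move=> minF resF resG.
have [phi [psi [gphi _ [h [N [dN phipsi]]] _]]] :=
  resolution_comparison i resF resG.
have := congr1 (fun M => constant_part M k k) phipsi.
rewrite map_mxM !map_mxD map_mx1 map_mxM (minimal_constant_part minF dN).
have -> : constant_part (diff F i) = 0 by apply/matrixP => ? ?; rewrite !mxE minF.
rewrite mulmx0 !addr0 [RHS]mxE eqxx => /eqP.
have [l nz|none] := pickP (fun l => (phi k l)@_0 != 0).
  by exists l; apply: graded_mx_const gphi nz.
rewrite mxE big1 => [|l _]; first by rewrite eq_sym oner_eq0.
by move/negbFE/eqP: (none l) => none_l; rewrite !mxE /= none_l mul0r.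
Qed.

(** Modulo the variables, [x] is a cycle of [G] and [y] a functional that vanishes on
    boundaries.  The composite [G -> F -> G] changes [x] by a boundary only, so it
    preserves the value [x *m y], and a nonzero value must pass through [F] in the
    degree of a basis element on which [y] is nonzero. *)
Lemma surviving_shift F G (eF : 'cV_(rank F 0)) (eG : 'cV_(rank G 0)) i
    (x : 'rV[K]_(rank G i)) (y : 'cV[K]_(rank G i)) :
    resolves I eF -> resolves I eG ->
    (forall p (N : 'M[R]_(rank G i, p)),
       from_diff N -> x *m constant_part N = 0) ->
    constant_part (diff G i) *m y = 0 -> x *m y != 0 ->
  exists (k : 'I_(rank F i)) (l : 'I_(rank G i)),
    y l 0 != 0 /\ shift k = shift l.
Proof.
move=> resF resG xcyc ycocyc xy.
have [phi [psi [gphi _ _ [h [N [dN psiphi]]]]]] :=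
  resolution_comparison i resF resG.
have := congr1 (fun M => x *m constant_part M *m y) psiphi.
rewrite map_mxM !map_mxD map_mx1 map_mxM !mulmxDr (xcyc _ _ dN) mulmx1 addr0.
rewrite mulmxDl -!mulmxA ycocyc !mulmx0 addr0 => E.
have [[k l] /= /andP[nzy nzphi]|none] :=
    pickP (fun kl => (y kl.2 0 != 0) && ((phi kl.1 kl.2)@_0 != 0)).
  by exists k, l; split=> //; apply: graded_mx_const gphi nzphi.
case/eqP: xy; rewrite -E.
suff -> : constant_part phi *m y = 0 by rewrite !mulmx0.
apply/colP => k; rewrite mxE [RHS]mxE; apply: big1 => l _; rewrite mxE /=.
by have /negbT := none (k, l); rewrite negb_and !negbK => /orP[/eqP->|/eqP->];
  rewrite ?mulr0 ?mul0r.
Qed.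

End Comparison.

(** * Multigraded complexes encoded by scalar matrices *)

Section Frames.
Variables (K : fieldType) (n mu : nat) (f : 'I_mu -> 'X_{1..n}).
Variables (N : nat) (mon : 'I_N -> 'X_{1..n}) (hdeg : 'I_N -> nat) (o : 'I_N).
Hypothesis mon_origin : mon o = 0%MM.
Hypothesis hdeg_eq0 : forall b, (hdeg b == 0%N) = (b == o).
Hypothesis mon_in_ideal : forall b, b != o -> exists j, (f j <= mon b)%MM.
Local Notation R := {mpoly K[n]}.
Implicit Types (S : {set 'I_N}) (a : 'M[K]_N) (m : 'X_{1..n}).

(** The vector space of scalar coordinates of the part of multidegree [m] of the free
    module on [S]: the basis element [b] contributes if [mon b] divides [m]. *)
Definition below S m (x : 'rV[K]_N) : Prop :=
  forall b, x 0 b != 0 -> (b \in S) && (mon b <= m)%MM.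

(** [a b c] is the coefficient of the monomial [mon b / mon c] in the entry of the
    differential from [b] to [c].  In multidegrees [m] outside the
    ideal only the origin contributes, and the homology is that of [R / I]; in the
    ideal the complex is exact in all homological degrees, including [0].  So one
    condition expresses that the complex resolves [R / I]. *)
Record is_frame S a : Prop := IsFrame {
  frame_origin : o \in S;
  frame_support : forall b c, a b c != 0 ->
    [/\ b \in S, c \in S, hdeg b = (hdeg c).+1 & (mon c <= mon b)%MM];
  frame_square : a *m a = 0;
  frame_exact : forall m, (exists j, (f j <= m)%MM) ->
    forall x, below S m x -> x *m a = 0 ->
    exists2 y, below S m y & x = y *m a
}.

Section FrameSequence.
Variables (S : {set 'I_N}) (a : 'M[K]_N).
Hypothesis fr : is_frame S a.

Definition level i : {set 'I_N} := [set b in S | hdeg b == i].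

Definition frame_diff i : 'M[R]_(#|level i.+1|, #|level i|) :=
  \matrix_(k, l) (a (enum_val k) (enum_val l)
                    *: 'X_[mon (enum_val k) - mon (enum_val l)]).

Definition frame_shift i (k : 'I_#|level i|) : int :=
  (mdeg (mon (enum_val k)))%:Z.

Lemma frame_diff_graded i k l m : m \in msupp (frame_diff i k l) ->
  frame_shift k = frame_shift l + (mdeg m)%:Z.
Proof.
rewrite mxE; have [->|nz] := eqVneq (a (enum_val k) (enum_val l)) 0.
  by rewrite scale0r msupp0.
have [_ _ _ le_lk] := frame_support fr nz.
rewrite msuppMCX // inE => /eqP->; rewrite /frame_shift -PoszD -mdegD.
by rewrite addmC submK.
Qed.

Definition frame_sequence : graded_free_sequence K n :=
  GradedFreeSequence frame_diff_graded.

Lemma enum_level i (k : 'I_#|level i|) :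
  enum_val k \in S /\ hdeg (enum_val k) = i.
Proof. by have := enum_valP k; rewrite inE => /andP[-> /eqP]. Qed.

(** The truncated difference is harmless: for [x] in [below S m] the coefficient
    vanishes when [mon (enum_val k)] does not divide [m]. *)
Definition homog_row i m (x : 'rV[K]_N) : 'rV[R]_#|level i| :=
  \row_k (x 0 (enum_val k) *: 'X_[m - mon (enum_val k)]).

Lemma homog_diff i m (y : 'rV[K]_N) : below S m y ->
  homog_row i.+1 m y *m frame_diff i = homog_row i m (y *m a).
Proof.
move=> ym; apply/rowP => l; rewrite !mxE scaler_suml.
transitivity (\sum_(b in level i.+1) (y 0 b * a b (enum_val l))
                *: ('X_[m - mon (enum_val l)] : R)).
  rewrite [RHS]big_enum_val; apply: eq_bigr => k _; rewrite !mxE.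
  rewrite -scalerAl -scalerAr scalerA -mpolyXD.
  have [->|nza] := eqVneq (a (enum_val k) (enum_val l)) 0.
    by rewrite mulr0 !scale0r.
  have [->|/ym/andP[_ le_m]] := eqVneq (y 0 (enum_val k)) 0.
    by rewrite mul0r !scale0r.
  have [_ _ _ le_lk] := frame_support fr nza.
  congr (_ *: 'X_[_]); apply/mnmP => t; rewrite !(mnmBE, mnmDE).
  by rewrite addnBA ?subnK //; apply/mnm_lepP.
rewrite [RHS](bigID (mem (level i.+1))) /= [X in _ = _ + X]big1 ?addr0 // => b.
have [_ hl] := enum_level l.
rewrite inE; have [->|nz] := eqVneq (a b (enum_val l)) 0.
  by rewrite mulr0 scale0r.
by have [-> _ ->] := frame_support fr nz; rewrite hl eqxx.
Qed.

Lemma frame_diff_diff i : frame_diff i.+1 *m frame_diff i = 0.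
Proof.
apply/row_matrixP => k; rewrite row_mul.
have -> : row k (frame_diff i.+1) =
    homog_row i.+1 (mon (enum_val k)) (row (enum_val k) a).
  by apply/rowP => l; rewrite !mxE.
rewrite homog_diff => [|b]; last first.
  by rewrite mxE => nz; have [_ -> _ ->] := frame_support fr nz.
rewrite -row_mul (frame_square fr).
by apply/rowP => l; rewrite !mxE scale0r.
Qed.

Definition component i m (v : 'rV[R]_#|level i|) : 'rV[K]_N :=
  \sum_k ((v 0 k)@_(m - mon (enum_val k)) *+ (mon (enum_val k) <= m)%MM)
           *: delta_mx 0 (enum_val k).

Lemma component_enum i m (v : 'rV[R]_#|level i|) k :
  component m v 0 (enum_val k) =
    (v 0 k)@_(m - mon (enum_val k)) *+ (mon (enum_val k) <= m)%MM.
Proof.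
rewrite summxE (bigD1 k) //= big1 => [|k' ne_k].
  by rewrite !mxE !eqxx mulr1 addr0.
by rewrite !mxE eqxx (inj_eq enum_val_inj) eq_sym (negPf ne_k) mulr0.
Qed.

Lemma component_below i m (v : 'rV[R]_#|level i|) : below S m (component m v).
Proof.
move=> b; rewrite summxE => nz.
have [k /eqP bk|none] :=
    pickP (fun k : 'I_#|level i| => b == enum_val k); last first.
  case/eqP: nz; apply: big1 => k _.
  by rewrite !mxE none andbF mulr0.
rewrite bk (proj1 (enum_level k)) /=; apply: contraNT nz => /negPf nle.
apply/eqP; apply: big1 => k' _; rewrite !mxE bk (inj_eq enum_val_inj) /=.
by case: eqP => [<-|_]; rewrite ?mulr0 // nle mul0r.
Qed.

Lemma component_sum i (v : 'rV[R]_#|level i|) :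
  exists L : seq 'X_{1..n}, v = \sum_(m <- L) homog_row i m (component m v).
Proof.
pose L := undup (flatten
  [seq [seq (m' + mon (enum_val k))%MM | m' <- msupp (v 0 k)]
  | k <- enum 'I_#|level i|]).
exists L; apply/rowP => k; rewrite summxE; apply/mpolyP => m.
rewrite raddf_sum /=.
under eq_bigr do rewrite mxE component_enum mcoeffZ mcoeffX.
have [mv|nmv] := boolP (m \in msupp (v 0 k)).
  rewrite (bigD1_seq (m + mon (enum_val k))%MM) ?undup_uniq //=; last first.
    rewrite mem_undup; apply/flattenP.
    exists [seq (m' + mon (enum_val k))%MM | m' <- msupp (v 0 k)].
      by apply/mapP; exists k; rewrite ?mem_enum.
    exact: map_f.
  rewrite addmK eqxx mulr1 lem_addl mulr1n big1 ?addr0 // => m' ne.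
  have [le_m'|] := boolP (_ <= m')%MM; last by rewrite mulr0n mul0r.
  case: eqP => [eq_m|]; last by rewrite mulr0.
  by case/eqP: ne; rewrite -eq_m submK.
rewrite (memN_msupp_eq0 nmv); apply/esym/big1 => m' _.
by case: eqP => [->|]; rewrite ?mulr0 // (memN_msupp_eq0 nmv) mul0rn mul0r.
Qed.

Lemma component_diff i m (v : 'rV[R]_#|level i.+1|) :
  v *m frame_diff i = 0 -> component m v *m a = 0.
Proof.
move=> vD; apply/rowP => c; rewrite mulmx_suml summxE mxE.
under eq_bigr do rewrite -scalemxAl -rowE !mxE.
have [cl|ncl] := boolP (c \in level i); last first.
  apply: big1 => k _; have [->|nz] := eqVneq (a (enum_val k) c) 0.
    by rewrite mulr0.
  case/negP: ncl; have [_ hk] := enum_level k.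
  have [_ cS hc _] := frame_support fr nz.
  by move: hc; rewrite hk => -[ic]; rewrite inE cS ic eqxx.
have [le_m|nle_m] := boolP (mon c <= m)%MM; last first.
  apply: big1 => k _; have [->|nz] := eqVneq (a (enum_val k) c) 0.
    by rewrite mulr0.
  have [_ _ _ le_ck] := frame_support fr nz.
  case: (boolP (mon (enum_val k) <= m)%MM) => [le_k|]; last by rewrite mul0r.
  by case/negP: nle_m; apply: lepm_trans le_ck le_k.
transitivity (((v *m frame_diff i) 0 (enum_rank_in cl c))@_(m - mon c)).
  rewrite mxE raddf_sum /=; apply: eq_bigr => k _.
  rewrite mxE enum_rankK_in // -scalerAr mcoeffZ mulrC.
  have [->|nz] := eqVneq (a (enum_val k) c) 0; first by rewrite !mul0r.
  have [_ _ _ le_ck] := frame_support fr nz.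
  rewrite mcoeffMX_div; congr (_ * (_@_ _ *+ nat_of_bool _)).
    apply/mnmP => t; rewrite !mnmBE subnBA ?subnK //; first exact/mnm_lepP.
    exact/mnm_lepP.
  apply/mnm_lepP/mnm_lepP => H t.
    by rewrite !mnmBE leq_sub2r.
  have := H t; rewrite !mnmBE leq_subLR subnKC //.
  exact/mnm_lepP.
by rewrite vD mxE mcoeff0.
Qed.

(** Exactness over [R] follows from exactness over [K]: lift the finitely many
    nonzero multihomogeneous components of [v] separately. *)
Lemma frame_lift i (v : 'rV[R]_#|level i|) :
    (forall m, (exists j, (f j <= m)%MM) -> component m v *m a = 0) ->
    (forall m, ~ (exists j, (f j <= m)%MM) -> component m v = 0) ->
  exists w, v = w *m frame_diff i.
Proof.
move=> cyc van; have [L ->] := component_sum v.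
apply: (big_ind (fun u => exists w, u = w *m frame_diff i)).
- by exists 0; rewrite mul0mx.
- by move=> _ _ [w1 ->] [w2 ->]; exists (w1 + w2); rewrite mulmxDl.
move=> m _; have [j le_j|none] := pickP (fun j => (f j <= m)%MM).
  have [||y ym ->] := frame_exact fr (m := m) _ (@component_below _ _ v) _.
  - by exists j.
  - by apply: cyc; exists j.
  by exists (homog_row i.+1 m y); rewrite homog_diff.
rewrite van => [|[j]]; last by rewrite none.
by exists 0; rewrite mul0mx; apply/rowP => k; rewrite !mxE scale0r.
Qed.

Lemma card_level0 : #|level 0| = 1%N.
Proof.
apply/eqP/cards1P; exists o; apply/setP => b; rewrite !inE hdeg_eq0.
by case: eqP => [->|]; rewrite ?andbF // (frame_origin fr).
Qed.

Lemma enum_level0 (k : 'I_#|level 0|) : enum_val k = o.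
Proof. by apply/eqP; rewrite -hdeg_eq0; have [_ ->] := enum_level k. Qed.

Definition frame_augmentation : 'cV[R]_#|level 0| := const_mx 1.

Lemma augmentationE (v : 'rV[R]_#|level 0|) k :
  (v *m frame_augmentation) 0 0 = v 0 k.
Proof.
rewrite mxE (bigD1 k) //= big1 ?addr0 => [|l /eqP[]]; first by rewrite mxE mulr1.
by apply: enum_val_inj; rewrite !enum_level0.
Qed.

Lemma frame_resolves (I : R -> Prop) :
    generates f [set: 'I_mu] I ->
  @resolves K n I frame_sequence frame_augmentation.
Proof.
move=> genI; have k0 : 'I_#|level 0| by rewrite card_level0; exact: ord0.
split=> [k m|p|v|i v].
- rewrite mxE msupp1 inE => /eqP->.
  by rewrite /= /frame_shift enum_level0 mon_origin.
- exists (const_mx p); rewrite (augmentationE _ k0) mxE subrr.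
  exact: (generated0 genI).
- split=> [|[w ->]].
    rewrite (augmentationE _ k0) => Iv; apply: frame_lift => m.
      move=> _; rewrite mulmx_suml big1 // => k _.
      rewrite -scalemxAl -rowE enum_level0.
      suff -> : row o a = 0 by rewrite scaler0.
      apply/rowP => c; rewrite !mxE; apply/eqP/negPn/negP => nz.
      have [_ _ ho _] := frame_support fr nz.
      by have := hdeg_eq0 o; rewrite ho eqxx.
    move=> none; rewrite /component big1 // => k _.
    have -> : k = k0 by apply: enum_val_inj; rewrite !enum_level0.
    rewrite enum_level0 mon_origin subm0 memN_msupp_eq0 ?mul0rn ?scale0r //.
    apply/negP => mv; apply: none.
    by have /(generated_msuppP genI)/(_ m mv)[j _] := Iv; exists j.
  rewrite -mulmxA mxE; apply: (generated_sum genI) => k.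
  apply: (generatedMl genI); rewrite mxE; apply: (generated_sum genI) => l.
  rewrite mxE mulrC enum_level0 mon_origin subm0 -mul_mpolyC mulrA.
  apply: (generatedMl genI); apply/(generatedX genI).
  have [|j le_j] := @mon_in_ideal (enum_val k); last by exists j.
  by rewrite -hdeg_eq0 (proj2 (enum_level k)).
split=> [vD|[w ->]]; last by rewrite -mulmxA frame_diff_diff mulmx0.
apply: frame_lift => m; first by move=> _; apply: component_diff.
move=> none; rewrite /component big1 // => k _.
case: (boolP (mon (enum_val k) <= m)%MM) => [le_k|_]; last by rewrite scale0r.
have [|j le_j] := @mon_in_ideal (enum_val k).
  by rewrite -hdeg_eq0 (proj2 (enum_level k)).
by case: none; exists j; apply: lepm_trans le_j le_k.
Qed.

Lemma frame_minimal :
    (forall b c, a b c != 0 -> mon b <> mon c) -> minimal frame_sequence.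
Proof.
move=> amin i k l; rewrite mxE mcoeffZ mcoeffX.
have [->|nz] := eqVneq (a (enum_val k) (enum_val l)) 0; first by rewrite mul0r.
case: eqP => [eq0|]; last by rewrite mulr0.
have [_ _ _ le_lk] := frame_support fr nz.
by case: (amin _ _ nz); rewrite -(submK le_lk) eq0 add0m.
Qed.

End FrameSequence.

(** * Gaussian elimination of unit entries *)

Section Cancellation.
Variables (S : {set 'I_N}) (a : 'M[K]_N) (b1 c1 : 'I_N).
Hypotheses (fr : is_frame S a) (a_neq0 : a b1 c1 != 0).
Hypotheses (mon_bc : mon b1 = mon c1) (c1_neq_o : c1 != o).

(** A partial inverse [P] of [a] with [P *m a *m P = P]; the Schur complement is then
    [a - a *m P *m a]. *)
Definition cancel_inv : 'M[K]_N := (a b1 c1)^-1 *: delta_mx c1 b1.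
Definition cancel_mx : 'M[K]_N := a - a *m cancel_inv *m a.
Definition cancel_set : {set 'I_N} := S :\ b1 :\ c1.
Definition cancelled : 'M[K]_N :=
  \matrix_(b, c) (cancel_mx b c *+ ((b \in cancel_set) && (c \in cancel_set))).

Lemma cancelledE b c : cancelled b c =
  cancel_mx b c *+ ((b \in cancel_set) && (c \in cancel_set)).
Proof. exact: mxE. Qed.

Lemma cancel_mxE b c : cancel_mx b c = a b c - (a b1 c1)^-1 * a b c1 * a b1 c.
Proof.
rewrite !mxE; congr (_ - _); rewrite (bigD1 b1) //= big1 ?addr0 => [|d ne_d].
  congr (_ * _); rewrite !mxE (bigD1 c1) //= big1 ?addr0 => [|d ne_d].
    by rewrite !mxE !eqxx mulr1 mulrC.
  by rewrite !mxE (negPf ne_d) !mulr0.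
rewrite mxE big1 ?mul0r // => e _.
by rewrite !mxE (negPf ne_d) andbF !mulr0.
Qed.

Lemma cancel_mx_row c : cancel_mx b1 c = 0.
Proof. by rewrite cancel_mxE mulVf // mul1r subrr. Qed.

Lemma cancel_mx_col b : cancel_mx b c1 = 0.
Proof. by rewrite cancel_mxE mulrAC mulVf // mul1r subrr. Qed.

Lemma frame_outside b c : c \notin S -> a b c = 0 /\ a c b = 0.
Proof.
move=> /negP cS; split; apply/eqP/negPn/negP => /(frame_support fr) [? ? _ _];
  exact: cS.
Qed.

Lemma cancel_mx_outside b c : c \notin S -> cancel_mx b c = 0.
Proof.
move=> cS; rewrite cancel_mxE.
by rewrite (proj1 (frame_outside b cS)) (proj1 (frame_outside b1 cS)) mulr0 subrr.
Qed.

(** Every term of the expansion contains the factor [a *m a]. *)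
Lemma cancel_mx_square : cancel_mx *m cancel_mx = 0.
Proof.
have aa := frame_square fr; rewrite /cancel_mx mulmxBl !mulmxBr aa !mulmxA aa.
rewrite -[_ *m cancel_inv *m a *m a]mulmxA aa mulmx0 !mul0mx.
by rewrite !subrr.
Qed.

Lemma cancelled_support b c : cancelled b c != 0 ->
  [/\ b \in cancel_set, c \in cancel_set, hdeg b = (hdeg c).+1
    & (mon c <= mon b)%MM].
Proof.
rewrite cancelledE; have [/andP[bS cS]|_] := boolP (_ && _); last by rewrite eqxx.
rewrite mulr1n cancel_mxE bS cS => nz.
have [abc|/(frame_support fr)[_ _ -> ->]//] := eqVneq (a b c) 0.
move: nz; rewrite abc sub0r oppr_eq0 !mulf_eq0 !negb_or.
move=> /andP[/andP[_ nz1] nz2].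
have [_ _ -> le1] := frame_support fr nz1.
have [_ _ <- le2] := frame_support fr nz2.
have [_ _ -> _] := frame_support fr a_neq0.
by split=> //; apply: lepm_trans le2 _; rewrite mon_bc.
Qed.

Lemma cancelled_square : cancelled *m cancelled = 0.
Proof.
apply/matrixP => b d; rewrite mxE [RHS]mxE.
have [bS|bS] := boolP (b \in cancel_set); last first.
  by rewrite big1 // => c _; rewrite cancelledE (negPf bS) mul0r.
have [dS|dS] := boolP (d \in cancel_set); last first.
  by rewrite big1 // => c _; rewrite [X in _ * X]cancelledE (negPf dS) andbF mulr0.
transitivity ((cancel_mx *m cancel_mx) b d); last first.
  by rewrite cancel_mx_square mxE.
rewrite mxE; apply: eq_bigr => c _; rewrite !cancelledE bS dS /= andbT.
have [//|cS] := boolP (c \in cancel_set); rewrite mul0r.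
have [->|ne_c] := eqVneq c c1; first by rewrite cancel_mx_col mul0r.
have [->|ne_b] := eqVneq c b1; first by rewrite cancel_mx_row mulr0.
rewrite cancel_mx_outside ?mul0r //.
by apply: contra cS; rewrite !inE ne_c ne_b.
Qed.

(** The cycle [x] of the smaller complex extends to a cycle of [a] by a coefficient
    at [b1].  It bounds in the larger complex, and the bounding chain can be moved
    off [c1] by a multiple of the boundary of [b1], which has a unit coefficient
    at [c1]. *)
Lemma cancelled_exact m : (exists j, (f j <= m)%MM) ->
  forall x, below cancel_set m x -> x *m cancelled = 0 ->
  exists2 y, below cancel_set m y & x = y *m cancelled.
Proof.
move=> mI x xm xa'.
have [b1S c1S hb1 _] := frame_support fr a_neq0.
have ne_bc : b1 != c1.
  by apply/eqP => bc; move: hb1; rewrite bc => /n_Sn.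
have xS b : b \notin cancel_set -> x 0 b = 0.
  by move=> bS; apply/eqP/negPn/negP => /xm/andP[bS' _]; rewrite bS' in bS.
have restrict (y : 'rV[K]_N) c : c \in cancel_set ->
    (forall b, b \notin cancel_set -> b != b1 -> y 0 b = 0) ->
    (y *m cancelled) 0 c = (y *m cancel_mx) 0 c.
  move=> cS yS; rewrite mxE [RHS]mxE; apply: eq_bigr => b _.
  rewrite cancelledE cS andbT.
  have [//|bS] := boolP (b \in cancel_set).
  have [->|ne_b] := eqVneq b b1; first by rewrite cancel_mx_row.
  by rewrite (yS b) // !mul0r.
(* The correction, supported at [b1], makes [x] a cycle of [a]. *)
pose z := x - x *m a *m cancel_inv.
have zE b : b != b1 -> z 0 b = x 0 b.
  move=> ne_b; rewrite !mxE big1 ?subr0 // => c _.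
  by rewrite !mxE (negPf ne_b) andbF !mulr0.
have za_cancel : z *m a = x *m cancel_mx.
  by rewrite /z mulmxBl mulmxBr !mulmxA.
have za c : c != b1 -> (z *m a) 0 c = 0.
  rewrite za_cancel => ne_c.
  have [cS|cS] := boolP (c \in cancel_set).
    by rewrite -restrict // ?xa' ?mxE // => b bS _; apply: xS.
  rewrite mxE big1 // => b _; have [->|ne_c1] := eqVneq c c1.
    by rewrite cancel_mx_col mulr0.
  rewrite cancel_mx_outside ?mulr0 //.
  by apply: contra cS; rewrite !inE ne_c ne_c1.
have za0 : z *m a = 0.
  apply/rowP => c; rewrite [RHS]mxE; have [->|/za//] := eqVneq c b1.
  have := congr1 (fun M : 'rV_N => M 0 c1) (mulmxA z a a).
  rewrite (frame_square fr) mulmx0 mxE [RHS]mxE (bigD1 b1) //=.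
  rewrite big1 => [|d /za->]; last by rewrite mul0r.
  by move/esym/eqP; rewrite addr0 mulf_eq0 (negPf a_neq0) orbF => /eqP.
have zm : below S m z.
  move=> b; have [->|ne_b] := eqVneq b b1; last first.
    by rewrite zE // => /xm; rewrite !inE => /andP[/and3P[_ _ ->]].
  rewrite b1S /= => nz; apply/negPn/negP => nle_b1.
  have xb1 : x 0 b1 = 0 by apply: xS; rewrite !inE eqxx andbF.
  case/eqP: nz; rewrite !mxE xb1 sub0r big1 ?oppr0 // => c _.
  rewrite !mxE; have [->|ne_c] := eqVneq c c1; last by rewrite !mulr0.
  rewrite big1 ?mul0r // => b' _.
  have [->|/(frame_support fr)[_ _ _ le1]] := eqVneq (a b' c1) 0.
    by rewrite mulr0.
  have [->|/xm/andP[_ le2]] := eqVneq (x 0 b') 0; first by rewrite mul0r.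
  by case/negP: nle_b1; rewrite mon_bc; apply: lepm_trans le1 le2.
have [y0 y0m zy0] := frame_exact fr mI zm za0.
(* Subtracting a multiple of the boundary of [b1] clears the coefficient of
   [c1]. *)
pose y := y0 - (y0 0 c1 / a b1 c1) *: row b1 a.
have yc1 : y 0 c1 = 0 by rewrite !mxE divfK // subrr.
have zy : z = y *m a.
  rewrite /y mulmxBl -scalemxAl -row_mul (frame_square fr) row0 scaler0 subr0.
  exact: zy0.
have ym : below S m y.
  move=> b; have [y0b|/y0m//] := eqVneq (y0 0 b) 0.
  rewrite !mxE y0b sub0r oppr_eq0 !mulf_eq0 !negb_or => /andP[/andP[nz _] nzb].
  have [_ -> _ le1] := frame_support fr nzb.
  by have /andP[_ le2] := y0m _ nz; apply: lepm_trans le1 _; rewrite mon_bc.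
exists (\row_b (y 0 b *+ (b \in cancel_set))).
  move=> b; rewrite mxE; case: (boolP (b \in cancel_set)); last by rewrite eqxx.
  by move=> _ /ym/andP[_ ->].
apply/rowP => c; have [cS|cS] := boolP (c \in cancel_set); last first.
  rewrite xS // mxE big1 // => b _.
  by rewrite cancelledE (negPf cS) andbF mulr0.
rewrite restrict // => [|b bS _]; last by rewrite mxE (negPf bS).
have -> : ((\row_b (y 0 b *+ (b \in cancel_set))) *m cancel_mx) 0 c =
    (y *m cancel_mx) 0 c.
  rewrite mxE [RHS]mxE; apply: eq_bigr => b _; rewrite mxE.
  have [//|bS] := boolP (b \in cancel_set).
  have [->|ne_b] := eqVneq b b1; first by rewrite cancel_mx_row !mulr0.
  have [->|ne_c] := eqVneq b c1; first by rewrite yc1 !mul0r.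
  have [->|/ym/andP[bS' _]] := eqVneq (y 0 b) 0; first by rewrite !mul0r.
  by case/negP: bS; rewrite !inE ne_b ne_c.
have /setD1P[ne_c1 /setD1P[ne_cb _]] := cS.
have z_inv : z *m cancel_inv = 0.
  apply/rowP => d; rewrite mxE [RHS]mxE; apply: big1 => e _.
  rewrite [cancel_inv _ _]mxE [delta_mx _ _ _ _]mxE.
  have [->|_] := eqVneq e c1; last by rewrite !mulr0.
  by rewrite zE 1?eq_sym // xS ?mul0r // !inE eqxx.
by rewrite mulmxBr !mulmxA -zy z_inv mul0mx subr0 zE.
Qed.

Lemma cancelled_frame : is_frame cancel_set cancelled.
Proof.
have [b1S c1S hb1 _] := frame_support fr a_neq0.
split.
- rewrite !inE eq_sym c1_neq_o (frame_origin fr) andbT /=.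
  by apply/eqP => ob; have := hdeg_eq0 o; rewrite eqxx [X in hdeg X]ob hb1.
- exact: cancelled_support.
- exact: cancelled_square.
- exact: cancelled_exact.
Qed.

End Cancellation.

(** Each cancellation removes two basis elements, so the process stops, and it
    can only stop at a minimal resolution. *)
Lemma minimal_frame_exists S a : (forall j, f j != 0%MM) -> is_frame S a ->
  exists S' a', is_frame S' a' /\ forall b c, a' b c != 0 -> mon b <> mon c.
Proof.
move=> f_neq0; have [k] := ubnP #|S|; elim: k S a => // k IHk S a ltSk fr.
have [[b1 c1] /= /andP[nz /eqP eq_bc]|none] :=
    pickP (fun bc => (a bc.1 bc.2 != 0) && (mon bc.1 == mon bc.2)); last first.
  exists S, a; split=> // b c nz /eqP eq_bc.
  by have := none (b, c); rewrite /= nz eq_bc.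
have [b1S c1S hb1 _] := frame_support fr nz.
(* A unit entry into the origin would put [1] into the ideal. *)
have c1_neq_o : c1 != o.
  apply/eqP => co; have [|j le_j] := @mon_in_ideal b1.
    by rewrite -hdeg_eq0 hb1.
  move: (f_neq0 j); rewrite (mnm_le0 (m := f j)) ?eqxx //.
  by rewrite -mon_origin -co -eq_bc.
apply: IHk (cancelled_frame fr nz eq_bc c1_neq_o).
rewrite ltnS in ltSk; apply: leq_trans ltSk.
apply/proper_card/properP; split; last by exists b1; rewrite // !inE eqxx andbF.
by apply/subsetP => b; rewrite !inE => /and3P[].
Qed.

End Frames.

(** * The Taylor complex *)

Section Taylor.
Variables (K : fieldType) (n mu : nat) (f : 'I_mu -> 'X_{1..n}).
Variable rk : 'I_mu -> nat.
Hypothesis rk_inj : injective rk.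
Implicit Types (T U : {set 'I_mu}) (j u v w : 'I_mu).

(** The vertices are ordered by an arbitrary injective rank, because the lower bound
    for the regularity needs an order adapted to the hypergraph. *)
Definition taylor_sign v T : K := (-1) ^+ #|[set u in T | (rk u < rk v)%N]|.

Lemma taylor_signK v T : taylor_sign v T * taylor_sign v T = 1.
Proof. by rewrite -expr2 sqrr_sign. Qed.

Lemma taylor_sign_lt v w T : w \in T -> (rk w < rk v)%N ->
  taylor_sign v T = - taylor_sign v (T :\ w).
Proof.
move=> wT lt_wv; rewrite /taylor_sign (cardsD1 w) inE wT lt_wv exprS mulN1r.
by congr (- (_ ^+ #|pred_of_set _|)); apply/setP => u; rewrite !inE andbA.
Qed.

Lemma taylor_sign_ge v w T : ~~ (rk w < rk v)%N ->
  taylor_sign v (T :\ w) = taylor_sign v T.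
Proof.
move=> nlt; congr (_ ^+ #|pred_of_set _|); apply/setP => u; rewrite !inE.
by case: eqP => [->|]; rewrite //= (negPf nlt) andbF.
Qed.

(** Removing two vertices in either order gives opposite signs: the later one loses a
    predecessor when the earlier one goes first. *)
Lemma taylor_sign_swap v w T : v \in T -> w \in T -> v != w ->
  taylor_sign v T * taylor_sign w (T :\ v) =
  - (taylor_sign w T * taylor_sign v (T :\ w)).
Proof.
move=> vT wT ne_vw; case: (ltngtP (rk v) (rk w)) => [lt|lt|/rk_inj/eqP]; last first.
- by rewrite (negPf ne_vw).
- rewrite (taylor_sign_lt wT lt) (taylor_sign_ge (v := w)) -?leqNgt ?(ltnW lt) //.
  by rewrite mulNr mulrC.
- rewrite (taylor_sign_lt vT lt) (taylor_sign_ge (v := v)) -?leqNgt ?(ltnW lt) //.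
  by rewrite mulNr opprK mulrC.
Qed.

(** The diagonal has to vanish separately in characteristic [2]. *)
Lemma sum_antisymmetric (G : 'I_mu -> 'I_mu -> K) :
    (forall v, G v v = 0) -> (forall v w, G v w = - G w v) ->
  \sum_v \sum_w G v w = 0.
Proof.
move=> G0 GN; pose H v w := if (v < w)%N then G v w else 0.
transitivity (\sum_v \sum_w (H v w - H w v)).
  apply: eq_bigr => v _; apply: eq_bigr => w _; rewrite /H.
  case: (ltngtP v w) => [_|_|/val_inj->]; first by rewrite subr0.
    by rewrite sub0r.
  by rewrite subrr.
under eq_bigr do rewrite sumrB; rewrite sumrB [X in _ - X]exchange_big /=.
by rewrite subrr.
Qed.

Definition taylor_coef T U : K :=
  \sum_(v in T | U == T :\ v) taylor_sign v T.

Lemma taylor_coef_neq0 T U :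
  taylor_coef T U != 0 -> exists2 v, v \in T & U = T :\ v.
Proof.
move=> nz; have [v /andP[vT /eqP]|none] :=
    pickP (fun v => (v \in T) && (U == T :\ v)).
  by exists v.
by case/eqP: nz; apply: big_pred0.
Qed.

Lemma sum_taylor_row T (G : {set 'I_mu} -> K) :
  \sum_U taylor_coef T U * G U = \sum_(v in T) taylor_sign v T * G (T :\ v).
Proof.
under eq_bigr do rewrite mulr_suml; rewrite (exchange_big_dep (mem T)) /=.
  apply: eq_bigr => v vT; rewrite (big_pred1 (T :\ v)) // => U.
  by rewrite vT.
by move=> U v _ /andP[].
Qed.

Lemma sum_taylor_col U (G : {set 'I_mu} -> K) :
  \sum_T G T * taylor_coef T U =
  \sum_(v | v \notin U) G (v |: U) * taylor_sign v (v |: U).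
Proof.
under eq_bigr do rewrite mulr_sumr.
rewrite (exchange_big_dep (fun v => v \notin U)) /= => [|T v _ /andP[_ /eqP->]].
  apply: eq_bigr => v vU; rewrite (big_pred1 (v |: U)) // => T /=.
  apply/andP/eqP => [[vT /eqP->]|->]; first by rewrite setD1K.
  by rewrite setU11 setU1K.
by rewrite !inE eqxx.
Qed.

Lemma taylor_coef_square T U :
  \sum_T' taylor_coef T T' * taylor_coef T' U = 0.
Proof.
rewrite sum_taylor_row.
pose G v w := if [&& v \in T, w \in T, v != w & U == T :\ v :\ w]
  then taylor_sign v T * taylor_sign w (T :\ v) else 0.
rewrite -[RHS](@sum_antisymmetric G) => [|v|v w].
- rewrite big_mkcond; apply: eq_bigr => v _; rewrite /G.
  have [vT|vT] := boolP (v \in T) => /=; last by rewrite big1.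
  rewrite mulr_sumr big_mkcond; apply: eq_bigr => w _.
  by rewrite !inE (eq_sym v) andbCA andbA.
- by rewrite /G eqxx !andbF.
rewrite /G [w == v]eq_sym setDDl setUC -setDDl [RHS]fun_if oppr0.
have [vT|_] /= := boolP (v \in T); last by rewrite andbF.
have [wT|//] /= := boolP (w \in T).
by case: andP => // -[ne_vw _]; apply: taylor_sign_swap.
Qed.

(** If all faces may be joined with the vertex [j], the complex is a cone with apex
    [j]; the coefficients on the right are those of the cone over the cycle [x]. *)
Lemma taylor_coef_cone j (x : {set 'I_mu} -> K) :
    (forall U, \sum_T x T * taylor_coef T U = 0) ->
  forall U, x U =
    \sum_(T : {set 'I_mu})
       (if j \in T then taylor_sign j T * x (T :\ j) else 0) * taylor_coef T U.
Proof.
move=> xa U; rewrite sum_taylor_col; have [jU|jU] := boolP (j \in U); last first.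
  rewrite (bigD1 j) //= setU11 setU1K // big1 => [|v /andP[_ ne_v]].
    by rewrite mulrAC taylor_signK mul1r addr0.
  by rewrite !inE (negPf jU) eq_sym (negPf ne_v) mul0r.
have := xa (U :\ j); rewrite sum_taylor_col (bigD1 j) ?setD11 //= setD1K // => xaj.
transitivity (- taylor_sign j U *
    \sum_(v | (v \notin U :\ j) && (v != j))
       x (v |: U :\ j) * taylor_sign v (v |: U :\ j)).
  move/eqP: xaj; rewrite addrC addr_eq0 => /eqP->.
  by rewrite mulrNN mulrCA taylor_signK mulr1.
rewrite mulr_sumr; apply: eq_big => [v|v /andP[vU ne_vj]].
  by rewrite !inE; case: eqP => [->|]; rewrite ?andbT // jU.
have {}vU : v \notin U by move: vU; rewrite !inE ne_vj.
have UE : v |: U :\ j = (v |: U) :\ j.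
  apply/setP => u; rewrite !inE; case: (u =P v) => [->|] //=.
  by rewrite ne_vj.
rewrite !inE jU orbT -UE.
have := @taylor_sign_swap j v (v |: U); rewrite !inE jU eqxx orbT => /(_ isT isT).
rewrite eq_sym => /(_ ne_vj); rewrite -UE setU1K //.
set s1 := taylor_sign j _; set s2 := taylor_sign v (v |: U :\ j).
set s3 := taylor_sign v _; set s4 := taylor_sign j U => swap.
have -> : s1 = - (s3 * s4) * s2.
  by rewrite -swap -mulrA taylor_signK mulr1.
rewrite !mulNr; congr (- _).
have s33 : s3 * s3 = 1 by apply: taylor_signK.
rewrite -[LHS]mul1r -s33; ring.
Qed.

Definition lcm_mnm T : 'X_{1..n} := [multinom \max_(v in T) f v t | t < n].

Lemma lcm_mnm_le T m : (lcm_mnm T <= m)%MM = [forall v in T, (f v <= m)%MM].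
Proof.
apply/mnm_lepP/forall_inP => [le_m v vT|le_m t].
  apply/mnm_lepP => t; apply: leq_trans (le_m t).
  by rewrite mnmE (bigD1 v) //= leq_maxl.
by rewrite mnmE; apply/bigmax_leqP => v /le_m/mnm_lepP.
Qed.

Lemma le_lcm_mnm v T : v \in T -> (f v <= lcm_mnm T)%MM.
Proof. by move: v; apply/forall_inP; rewrite -lcm_mnm_le lepm_refl. Qed.

Lemma lcm_mnmS T U : T \subset U -> (lcm_mnm T <= lcm_mnm U)%MM.
Proof.
by move/subsetP=> sTU; rewrite lcm_mnm_le; apply/forall_inP => v /sTU/le_lcm_mnm.
Qed.

Let N := #|{set 'I_mu}|.
Definition taylor_mon (b : 'I_N) : 'X_{1..n} := lcm_mnm (enum_val b).
Definition taylor_deg (b : 'I_N) : nat := #|enum_val b|.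
Definition taylor_origin : 'I_N := enum_rank set0.
Definition taylor_mx : 'M[K]_N :=
  \matrix_(b, c) taylor_coef (enum_val b) (enum_val c).

Lemma taylor_mon_origin : taylor_mon taylor_origin = 0%MM.
Proof. by apply/mnmP => t; rewrite mnmE enum_rankK big_set0 mnm0E. Qed.

Lemma taylor_deg_eq0 b : (taylor_deg b == 0%N) = (b == taylor_origin).
Proof. by rewrite /taylor_deg cards_eq0 -(inj_eq enum_val_inj) enum_rankK. Qed.

Lemma taylor_mon_in_ideal b :
  b != taylor_origin -> exists j, (f j <= taylor_mon b)%MM.
Proof.
rewrite -taylor_deg_eq0 cards_eq0 => /set0Pn[j jb]; exists j.
exact: le_lcm_mnm.
Qed.

Lemma sum_enum_set (G : {set 'I_mu} -> K) :
  \sum_(b < N) G (enum_val b) = \sum_T G T.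
Proof.
rewrite [RHS](reindex (fun b : 'I_N => enum_val b)) //.
by apply/onW_bij/enum_val_bij.
Qed.

Lemma taylor_frame :
  is_frame f taylor_mon taylor_deg taylor_origin [set: 'I_N] taylor_mx.
Proof.
split=> [|b c||m [j le_j] x xm xa].
- by rewrite inE.
- rewrite mxE => /taylor_coef_neq0[v vb cE]; rewrite !inE; split=> //.
    by rewrite /taylor_deg (cardsD1 v) vb -cE.
  by rewrite /taylor_mon cE; apply/lcm_mnmS/subD1set.
- apply/matrixP => b c; rewrite mxE [RHS]mxE.
  under eq_bigr do rewrite 2!mxE.
  rewrite (sum_enum_set (fun T => taylor_coef (enum_val b) T
                                  * taylor_coef T (enum_val c))).
  exact: taylor_coef_square.
pose X T := x 0 (enum_rank T).
have Xa U : \sum_T X T * taylor_coef T U = 0.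
  transitivity ((x *m taylor_mx) 0 (enum_rank U)); last by rewrite xa mxE.
  rewrite mxE.
  rewrite -(sum_enum_set (fun T => X T * taylor_coef T U)).
  apply: eq_bigr => b _.
  by rewrite /X enum_valK mxE enum_rankK.
(* The cone construction stays in multidegree [m] because [f j] divides [m]. *)
pose Y T := if j \in T then taylor_sign j T * X (T :\ j) else 0.
exists (\row_b Y (enum_val b)) => [b|].
  rewrite mxE /Y inE /=; case: ifP => [jb nz|]; last by rewrite eqxx.
  have {}nz : X (enum_val b :\ j) != 0.
    by apply: contraNneq nz => ->; rewrite mulr0.
  have /andP[_] := xm _ nz; rewrite /taylor_mon enum_rankK !lcm_mnm_le.
  move=> /forall_inP le_m; apply/forall_inP => v vb.
  by have [->//|ne_v] := eqVneq v j; apply: le_m; rewrite !inE ne_v.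
apply/rowP => c; rewrite mxE; under eq_bigr do rewrite 2!mxE.
rewrite (sum_enum_set (fun T => Y T * taylor_coef T (enum_val c))).
by rewrite -(taylor_coef_cone j Xa) /X enum_valK.
Qed.

End Taylor.

(** * Minimal edges of a labeled hypergraph *)

Section MinimalEdges.
Variables (A V : finType) (E : A -> {set V}).
Implicit Types (F G T : {set V}) (v w : V).

(** The simple edges together with the singletons of the closed vertices. *)
Definition minimal_edges : {set {set V}} :=
  [set F in edges E | (F != set0) &&
    [forall G in edges E, (G != set0) ==> ~~ (G \proper F)]].

Definition transversal_set T : bool :=
  [forall F in minimal_edges, F :&: T != set0].

Lemma minimal_edgesP F G : F \in minimal_edges -> G \in edges E -> G != set0 ->
  G \subset F -> G = F.
Proof.
rewrite inE => /and3P[_ _ /forall_inP minF] GE G0 sGF.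
have /implyP/(_ G0) := minF _ GE; rewrite properE sGF negbK => sFG.
by apply/eqP; rewrite eqEsubset sGF.
Qed.

Lemma minimal_edge_neq0 F : F \in minimal_edges -> F != set0.
Proof. by rewrite inE => /and3P[]. Qed.

Lemma minimal_edge_label F : F \in minimal_edges -> exists a, F = E a.
Proof. by rewrite inE => /andP[/imsetP[a _ ->] _]; exists a. Qed.

Lemma simple_edgeE F :
  simple_edge E F = (F \in minimal_edges) && (1 < #|F|)%N.
Proof.
rewrite /simple_edge inE; case: (F \in edges E) => //=.
case: (ltnP 1 #|F|) => [lt1|_]; last by rewrite andbF.
by rewrite -card_gt0 (ltn_trans _ lt1) ?andbT.
Qed.

Lemma minimal_edge_below a : E a != set0 ->
  exists2 F, F \in minimal_edges & F \subset E a.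
Proof.
move=> Ea0; pose P F := [&& F \in edges E, F != set0 & F \subset E a].
have PE : P (E a) by rewrite /P Ea0 subxx imset_f.
case: (arg_minnP (fun F : {set V} => #|F|) PE) => F /and3P[FE F0 sF] minF.
exists F; rewrite // inE FE F0 /=; apply/forall_inP => G GE; apply/implyP => G0.
apply/negP => pGF; have := proper_card pGF; rewrite ltnNge => /negP[].
by apply: minF; rewrite /P GE G0 (subset_trans (proper_sub pGF)).
Qed.

(** Meeting the minimal edges suffices to meet all nonempty edges. *)
Lemma transversal_labels T a : transversal_set T ->
  (E a :&: T != set0) = (a \in labels E).
Proof.
move=> /forall_inP trT; rewrite inE.
have [->|Ea0] := eqVneq (E a) set0; first by rewrite set0I eqxx.
have [F /trT/set0Pn[v /setIP[vF vT]] /subsetP sF] := minimal_edge_below Ea0.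
by apply/set0Pn; exists v; rewrite inE vT sF.
Qed.

Lemma closed_minimal_edge v : closed_vertex E v -> [set v] \in minimal_edges.
Proof.
move=> cv; rewrite inE -card_gt0 cards1; apply/and3P; split=> //.
apply/forall_inP => G _; rewrite -card_gt0; apply/implyP => G0.
by apply/negP => /proper_card; rewrite cards1 ltnS leqNgt G0.
Qed.

Section Isolated.
Hypothesis iso : isolated_simple_edges E.

Lemma minimal_edge_uniq v F G :
  F \in minimal_edges -> G \in minimal_edges -> v \in F -> v \in G -> F = G.
Proof.
move=> FM GM vF vG; have [cv|ov] := boolP (closed_vertex E v).
  have v0 : [set v] != set0 by rewrite -card_gt0 cards1.
  by rewrite -(minimal_edgesP FM cv) ?sub1set // (minimal_edgesP GM cv) ?sub1set.
have simple H : H \in minimal_edges -> v \in H -> simple_edge E H.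
  move=> HM vH; rewrite simple_edgeE HM ltnNge; apply: contra ov => le1.
  have /eqP HE : [set v] == H by rewrite eqEcard sub1set vH cards1.
  by move: HM; rewrite inE /closed_vertex HE => /andP[].
have [H [_ uniqH]] := iso ov.
by rewrite -(uniqH F) ?(uniqH G) //; split=> //; apply: simple.
Qed.

(** The closed vertices are singleton blocks, and the simple edges partition the
    open vertices. *)
Lemma minimal_edges_partition : partition minimal_edges [set: V].
Proof.
apply/and3P; split.
- rewrite eqEsubset subsetT /=; apply/subsetP => v _; apply/bigcupP.
  have [cv|/iso[F [[sF vF] _]]] := boolP (closed_vertex E v).
    by exists [set v]; rewrite ?set11 ?closed_minimal_edge.
  by exists F => //; move: sF; rewrite simple_edgeE => /andP[].
- apply/trivIsetP => F G FM GM; apply: contraNT; rewrite -setI_eq0.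
  by case/set0Pn => v /setIP[vF vG]; apply/eqP/(minimal_edge_uniq FM GM vF vG).
- by apply/negP => /minimal_edge_neq0; rewrite eqxx.
Qed.

Lemma sum_simple_edges :
  \sum_(F in edges E | simple_edge E F) (#|F|%:Z - 1) =
  #|V|%:Z - #|minimal_edges|%:Z.
Proof.
transitivity (\sum_(F in minimal_edges) (#|F|%:Z - 1)).
  rewrite [RHS](bigID (fun F => 1 < #|F|)%N) /= [X in _ = _ + X]big1 ?addr0.
    apply: eq_bigl => F; rewrite simple_edgeE.
    case FM: (F \in minimal_edges); rewrite ?andbF //.
    by move: FM; rewrite inE => /andP[->].
  move=> F /andP[/minimal_edge_neq0]; rewrite -card_gt0 -leqNgt.
  by case: #|F| => [//|[|//]]; rewrite subrr.
rewrite sumrB sumr_const natz -cardsT (card_partition minimal_edges_partition).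
rewrite -[in RHS]natz natr_sum; congr (_ - _).
by apply: eq_bigr => F _; rewrite natz.
Qed.

(** Each of the disjoint minimal edges either meets [T], and then accounts for a
    vertex of [T] of its own, or is [E a] for a label [a] that misses [T]. *)
Lemma minimal_edges_bound T :
  (#|minimal_edges| + #|[set a | E a :&: T != set0]| <= #|T| + #|labels E|)%N.
Proof.
have /and3P[_ trM _] := minimal_edges_partition.
pose hit := [set F in minimal_edges | F :&: T != set0].
pose miss := minimal_edges :\: hit.
have hitT : (#|hit| <= #|T|)%N.
  apply: leq_trans (leq_imset_card (pblock minimal_edges) T).
  apply/subset_leq_card/subsetP => F; rewrite inE => /andP[FM /set0Pn[v]].
  case/setIP => vF vT; apply/imsetP; exists v => //.
  by rewrite (def_pblock trM FM vF).
have missT : (#|miss| + #|[set a | E a :&: T != set0]| <= #|labels E|)%N.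
  pose L := labels E :\: [set a | E a :&: T != set0].
  have miss_L : (#|miss| <= #|L|)%N.
    apply: leq_trans (leq_imset_card E L).
    apply/subset_leq_card/subsetP => F /setDP[FM]; rewrite in_set FM /=.
    have [a FE] := minimal_edge_label FM => FT; apply/imsetP; exists a => //.
    by rewrite 3!in_set -FE FT minimal_edge_neq0.
  apply: leq_trans (leq_add miss_L (leqnn _)) _.
  rewrite addnC -(cardsID [set a | E a :&: T != set0] (labels E)) leq_add2r.
  apply/subset_leq_card/subsetP => a; rewrite !inE => aT; rewrite aT andbT.
  by apply: contraNneq aT => ->; rewrite set0I.
have sub : hit \subset minimal_edges by apply/subsetP => F; rewrite inE => /andP[].
rewrite -(cardsID hit minimal_edges) (setIidPr sub) -addnA.
exact: leq_add hitT missT.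
Qed.

Lemma minimal_transversal :
  exists2 T, transversal_set T & #|T| = #|minimal_edges|.
Proof.
have /transversalP trT := minimal_edges_partition.
exists (transversal minimal_edges [set: V]); last exact: card_transversal trT.
have /and3P[_ _ /forall_inP one] := trT.
apply/forall_inP => F /one; rewrite setIC -card_gt0.
by move=> /eqP->.
Qed.

(** By counting, [T :\ v] meets every minimal edge exactly once.  So [T] meets the
    edge through [v] in exactly one more vertex [w], which can be dropped instead
    of [v], and any other vertex of [T] is the only one in its edge. *)
Lemma transversal_faces T v : v \in T -> transversal_set (T :\ v) ->
    #|T| = #|minimal_edges|.+1 ->
  exists w, [/\ w \in T, w != v,
     transversal_set (T :\ w),
     (forall u, u \in T -> transversal_set (T :\ u) -> u = v \/ u = w) &
     (forall u, u \in T ->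
        pblock minimal_edges u = pblock minimal_edges v -> u = v \/ u = w) /\
     pblock minimal_edges w = pblock minimal_edges v].
Proof.
move=> vT trv cardT; have PM := minimal_edges_partition.
have /and3P[/eqP covM trM M0] := PM.
have blkM u : pblock minimal_edges u \in minimal_edges.
  by rewrite pblock_mem // covM inE.
have blk_in u : u \in pblock minimal_edges u by rewrite mem_pblock covM inE.
have blkE F u : F \in minimal_edges -> u \in F -> pblock minimal_edges u = F.
  by move=> FM uF; apply: def_pblock.
have cardTv : #|T :\ v| = #|minimal_edges|.
  by move: cardT; rewrite (cardsD1 v) vT => -[].
have blk_inj : {in T :\ v &, injective (pblock minimal_edges)}.
  apply/imset_injP; rewrite eqn_leq leq_imset_card cardTv /=.
  apply/subset_leq_card/subsetP => F FM.
  have /set0Pn[u /setIP[uF uT]] := forall_inP trv F FM.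
  by apply/imsetP; exists u; rewrite ?(blkE F u).
have /set0Pn[w /setIP[wv wTv]] := forall_inP trv _ (blkM v).
have blkwv := blkE _ _ (blkM v) wv.
have /setD1P[ne_wv wT] := wTv.
have same u : u \in T -> pblock minimal_edges u = pblock minimal_edges v ->
    u = v \/ u = w.
  move=> uT blk_u; have [->|ne_uv] := eqVneq u v; first by left.
  by right; apply: blk_inj; rewrite ?blkwv // !inE ne_uv.
exists w; split=> //.
- apply/forall_inP => F FM; have /set0Pn[u /setIP[uF uTv]] := forall_inP trv F FM.
  have /setD1P[ne_uv uT] := uTv; apply/set0Pn.
  have [uw|ne_uw] := eqVneq u w; last by exists u; rewrite !inE uF ne_uw.
  exists v; rewrite !inE vT eq_sym ne_wv -(blkE F u) // uw blkwv blk_in.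
  by [].
- move=> u uT tru.
  have /set0Pn[x /setIP[xu /setD1P[ne_xu xT]]] := forall_inP tru _ (blkM u).
  have blk_xu := blkE _ _ (blkM u) xu.
  have [->|ne_uv] := eqVneq u v; first by left.
  have [xv|ne_xv] := eqVneq x v; first by apply: same; rewrite // -blk_xu xv.
  by case/eqP: ne_xu; apply: blk_inj; rewrite // !inE ?ne_xv ?ne_uv.
Qed.

End Isolated.

End MinimalEdges.

(** * The regularity of the Taylor complex *)

Section BlockOrder.
Variables (K : fieldType) (n mu : nat) (E : 'I_n -> {set 'I_mu}).
Hypothesis iso : isolated_simple_edges E.
Implicit Types (T : {set 'I_mu}) (u v w : 'I_mu).
Local Notation blk := (pblock (minimal_edges E)).

(** Ranking first by block makes every minimal edge an interval, so that [v] and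
    [w] are neighbours in any set whose elements in their block are [v] and [w]. *)
Definition block_rank v : nat := (enum_rank (blk v) * mu + v)%N.

Lemma block_rank_div v : (block_rank v %/ mu)%N = enum_rank (blk v).
Proof.
rewrite /block_rank divnMDl ?divn_small ?addn0 //.
exact: leq_ltn_trans (leq0n v) (ltn_ord v).
Qed.

Lemma block_rank_inj : injective block_rank.
Proof.
move=> v w vw; apply: val_inj => /=; move: (vw).
have /(congr1 (fun k => k * mu)%N) : (block_rank v %/ mu = block_rank w %/ mu)%N.
  by rewrite vw.
by rewrite !block_rank_div /block_rank => -> /addnI.
Qed.

Lemma block_rank_between u v w : (block_rank u <= block_rank v)%N ->
  (block_rank v <= block_rank w)%N -> blk u = blk w -> blk v = blk u.
Proof.
move=> /(leq_div2r mu) le_uv /(leq_div2r mu) le_vw uw.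
move: le_uv le_vw; rewrite !block_rank_div -uw => le_uv le_vw.
by apply: enum_rank_inj; apply/val_inj/eqP; rewrite eqn_leq le_vw.
Qed.

(** Modulo the variables, the part of the Taylor complex spanned by the transversals
    is the tensor product, over the minimal edges, of the chain complexes of full
    simplices; its homology is one-dimensional, and this functional detects it. *)
Definition top_cocycle T : K :=
  (transversal_set E T && (#|T| == #|minimal_edges E|))%:R.

Lemma taylor_sign_adjacent T v w : v \in T -> w \in T -> v != w ->
    blk v = blk w ->
    (forall u, u \in T -> blk u = blk v -> u = v \/ u = w) ->
  taylor_sign K block_rank v T + taylor_sign K block_rank w T = 0.
Proof.
wlog lt_vw : v w / (block_rank v < block_rank w)%N => [wl|] vT wT ne_vw bvw same.
  case: (ltngtP (block_rank v) (block_rank w)) => [lt|lt|/block_rank_inj/eqP].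
  - exact: wl.
  - rewrite addrC; apply: wl => //; first by rewrite eq_sym.
    by move=> u uT; rewrite -bvw => /(same u uT)[]; [right|left].
  - by rewrite (negPf ne_vw).
rewrite (taylor_sign_lt K vT lt_vw); apply/eqP; rewrite subr_eq0; apply/eqP.
congr (_ ^+ #|pred_of_set _|); apply/setP => u; rewrite !inE.
case uT: (u \in T); rewrite ?andbF //= andbT.
have [->|ne_uv] := eqVneq u v; first by rewrite ltnn.
apply/idP/idP => [lt|/= lt]; first exact: ltn_trans lt lt_vw.
rewrite ltnNge; apply/negP => le_vu.
have [/eqP|uw] := same u uT (block_rank_between le_vu (ltnW lt) bvw).
  by rewrite (negPf ne_uv).
by rewrite uw ltnn in lt.
Qed.

(** The two faces of [T] on which [top_cocycle] is nonzero come from removing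
    neighbours in the block order, so they have opposite signs. *)
Lemma top_cocycle_boundary T :
  \sum_(v in T) taylor_sign K block_rank v T * top_cocycle (T :\ v) = 0.
Proof.
rewrite /top_cocycle.
have [v /and3P[vT trv /eqP cTv]|none] := pickP (fun v => [&& v \in T,
    transversal_set E (T :\ v) & #|T :\ v| == #|minimal_edges E|]); last first.
  by apply: big1 => v vT; have := none v; rewrite vT /= => ->; rewrite mulr0.
have cT : #|T| = #|minimal_edges E|.+1 by rewrite (cardsD1 v) vT cTv.
have [w [wT ne_wv trw only [same blkwv]]] := transversal_faces iso vT trv cT.
have cD u : u \in T -> #|T :\ u| = #|minimal_edges E|.
  by move=> uT; move: cT; rewrite (cardsD1 u) uT => -[].
rewrite (bigD1 v) //= (bigD1 w) ?wT //= trv trw !cD // eqxx !mulr1.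
rewrite addrA taylor_sign_adjacent //; last by rewrite eq_sym.
rewrite add0r big1 // => u /andP[/andP[uT ne_uv] ne_uw].
case tru: (transversal_set E _); last by rewrite mulr0.
by have [/eqP|/eqP] := only u uT tru; rewrite ?(negPf ne_uv) ?(negPf ne_uw).
Qed.

End BlockOrder.

Section SquarefreeTaylor.
Variables (K : fieldType) (n mu : nat) (f : 'I_mu -> 'X_{1..n}).
Hypothesis sqf : forall j, squarefree_monomial (f j).
Local Notation E := (hypergraph_edge f).
Implicit Types T : {set 'I_mu}.

Lemma lcm_mnmE T a : lcm_mnm f T a = (E a :&: T != set0).
Proof.
rewrite mnmE; have [E0|/set0Pn[v /setIP[vE vT]]] := eqVneq (E a :&: T) set0.
  apply: big1 => v vT; apply/eqP; apply: contraFT (in_set0 v).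
  by rewrite -E0 !inE vT lep1mP andbT.
apply/eqP; rewrite eqn_leq; apply/andP; split.
  by apply/bigmax_leqP => *; apply: sqf.
rewrite (bigD1 v) //= leq_max lt0n.
by move: vE; rewrite inE lep1mP => ->.
Qed.

Lemma mdeg_lcm_mnm T : mdeg (lcm_mnm f T) = #|[set a | E a :&: T != set0]|.
Proof.
rewrite mdegE -sum1_card [RHS]big_mkcond; apply: eq_bigr => a _.
by rewrite lcm_mnmE inE; case: (_ != _).
Qed.

Lemma transversal_lcm T a :
  transversal_set E T -> lcm_mnm f T a = (a \in labels E).
Proof. by rewrite lcm_mnmE => /transversal_labels ->. Qed.

Lemma transversal_mdeg T :
  transversal_set E T -> mdeg (lcm_mnm f T) = #|labels E|.
Proof.
move=> trT; rewrite mdeg_lcm_mnm; apply: eq_card => a.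
by rewrite inE transversal_labels.
Qed.

Hypothesis iso : isolated_simple_edges E.
Variable I : {mpoly K[n]} -> Prop.
Hypothesis genI : generates f [set: 'I_mu] I.

Definition taylor_sequence : graded_free_sequence K n :=
  frame_sequence (taylor_frame K f (@block_rank_inj n mu E)).
Local Notation G := taylor_sequence.

Lemma taylor_resolves : exists e : 'cV_(rank G 0), resolves I e.
Proof.
eexists; exact: (frame_resolves (@taylor_mon_origin n mu f) (@taylor_deg_eq0 mu)
  (@taylor_mon_in_ideal n mu f) (taylor_frame K f (@block_rank_inj n mu E)) genI).
Qed.

Definition taylor_face i (l : 'I_(rank G i)) : {set 'I_mu} :=
  enum_val (enum_val l).

Lemma card_taylor_face i (l : 'I_(rank G i)) : #|taylor_face l| = i.
Proof. by have [_] := enum_level l. Qed.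

Lemma taylor_faceP i T :
  #|T| = i -> exists l : 'I_(rank G i), taylor_face l = T.
Proof.
move=> cT; have Tl : enum_rank T \in level (@taylor_deg mu) setT i.
  by rewrite !inE /taylor_deg enum_rankK cT eqxx.
exists (enum_rank_in Tl (enum_rank T)).
by rewrite /taylor_face enum_rankK_in ?enum_rankK.
Qed.

Lemma sum_taylor_face i (H : {set 'I_mu} -> K) :
    (forall T, #|T| != i -> H T = 0) ->
  \sum_(l < rank G i) H (taylor_face l) = \sum_T H T.
Proof.
move=> H0; rewrite -sum_enum_set.
rewrite (bigID (mem (level (@taylor_deg mu) setT i))) /= addrC.
rewrite [X in _ = X + _]big1 ?add0r.
  by rewrite [RHS]big_enum_val.
by move=> b; rewrite !inE => /H0.
Qed.

Lemma constant_diff i k l : map_mx (mcoeff 0%MM) (diff G i) k l =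
  taylor_coef K (block_rank E) (taylor_face k) (taylor_face l)
    *+ (lcm_mnm f (taylor_face k) - lcm_mnm f (taylor_face l) == 0)%MM.
Proof. by rewrite !mxE /= mcoeffZ mcoeffX mulr_natr. Qed.

Lemma taylor_shift_le i (l : 'I_(rank G i)) :
  shift l - i%:Z <= #|labels E|%:Z - #|minimal_edges E|%:Z.
Proof.
have := minimal_edges_bound iso (taylor_face l).
rewrite -mdeg_lcm_mnm card_taylor_face => bound.
rewrite lerBlDr addrAC lerBrDr -!PoszD lez_nat.
by rewrite addnC [X in (_ <= X)%N]addnC.
Qed.

(** A minimal transversal loses a label with any of its vertices: its basis
    vector is a cycle modulo the variables. *)
Lemma transversal_constant_diff i (k : 'I_(rank G i.+1)) :
    transversal_set E (taylor_face k) -> i.+1 = #|minimal_edges E| ->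
  row k (map_mx (mcoeff 0%MM) (diff G i)) = 0.
Proof.
move=> trk ir; apply/rowP => l; rewrite mxE constant_diff [RHS]mxE.
case: eqP => // /mnmP eq0; have := minimal_edges_bound iso (taylor_face l).
rewrite -mdeg_lcm_mnm card_taylor_face -ir -(transversal_mdeg trk) => bound.
have : (mdeg (lcm_mnm f (taylor_face k)) <= mdeg (lcm_mnm f (taylor_face l)))%N.
  rewrite !mdegE; apply: leq_sum => a _.
  by have /eqP := eq0 a; rewrite mnmBE mnm0E subn_eq0.
by rewrite -(leq_add2l i.+1) => /leq_trans/(_ bound); rewrite leq_add2r ltnn.
Qed.

(** The constant entries between transversals are all the entries of the boundary map
    of the simplex, as transversals have the same least common multiple; faces of
    other sets are not transversal. *)
Lemma constant_diff_cocycle :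
  map_mx (mcoeff 0%MM) (diff G #|minimal_edges E|) *m
    (\col_l top_cocycle K E (taylor_face l)) = 0.
Proof.
set r := #|_|; apply/colP => k; rewrite mxE [RHS]mxE.
pose H U := taylor_coef K (block_rank E) (taylor_face k) U * top_cocycle K E U.
transitivity (\sum_(l < rank G r) H (taylor_face l)).
  apply: eq_bigr => l _; rewrite constant_diff mxE /H.
  set c := taylor_coef _ _ _ _.
  have [->|nzc] := eqVneq c 0; first by rewrite mul0rn !mul0r.
  rewrite /top_cocycle.
  case trl: (transversal_set E (taylor_face l)); last by rewrite !mulr0.
  have trk : transversal_set E (taylor_face k).
    have [v _ lE] := taylor_coef_neq0 nzc; apply/forall_inP => F FM.
    have /set0Pn[u] := forall_inP trl F FM.
    by rewrite lE !inE => /and3P[uF _ uk]; apply/set0Pn; exists u; rewrite inE uF.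
  suff -> : (lcm_mnm f (taylor_face k) - lcm_mnm f (taylor_face l) == 0)%MM by [].
  by apply/eqP/mnmP => a; rewrite mnmBE mnm0E !transversal_lcm // subnn.
rewrite sum_taylor_face; first by rewrite sum_taylor_row top_cocycle_boundary.
by move=> T /negPf cT; rewrite /H /top_cocycle cT andbF mulr0.
Qed.

(** The basis vector of a minimal transversal is a cycle modulo the variables on which
    [top_cocycle] takes the value [1]. *)
Lemma top_shift F (e : 'cV_(rank F 0)) : resolves I e ->
  exists k : 'I_(rank F #|minimal_edges E|), shift k = #|labels E|%:Z.
Proof.
move=> resF; have [eG resG] := taylor_resolves.
have [T0 trT0 cT0] := minimal_transversal iso.
have [k0 k0E] := taylor_faceP cT0.
have [||k [l [nzl kl]]] := surviving_shift genI (x := delta_mx 0 k0) resF resG _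
    constant_diff_cocycle.
- move=> p N; rewrite -rowE.
  (* [from_diff] is defined by cases on the homological degree. *)
  move: {-2}#|_| (erefl #|minimal_edges E|) k0 k0E N => [|i] /= ir k0 k0E N.
    by move=> ->; rewrite map_mx0 row0.
  move=> [h ->]; rewrite map_mxM row_mul transversal_constant_diff ?mul0mx //.
  by rewrite k0E.
- apply/eqP => /matrixP/(_ 0 0); rewrite -rowE !mxE /top_cocycle k0E trT0 cT0 eqxx.
  by move/eqP; rewrite oner_eq0.
exists k; rewrite kl; move: nzl; rewrite mxE /top_cocycle.
case trl: (transversal_set E _); last by rewrite eqxx.
by move=> _; rewrite -(transversal_mdeg trl).
Qed.

End SquarefreeTaylor.

(** * Minimal generators *)

Section MinimalGenerators.
Variables (K : fieldType) (n mu : nat) (f : 'I_mu -> 'X_{1..n}).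
Variable I : {mpoly K[n]} -> Prop.
Hypothesis minI : minimal_monomial_generators I f.

(** A generator divisible by another one could be dropped. *)
Lemma minimal_generators_antichain i j : (f i <= f j)%MM -> i = j.
Proof.
case: minI => genI minS le_ij; apply/eqP/negPn/negP => ne_ij.
have : generates f [set~ j] I.
  move=> p; rewrite (generated_msuppP genI) monomial_spanP.
  split=> Ip m /Ip[k _ le_k]; last by exists k; rewrite ?inE.
  have [kj|ne_kj] := eqVneq k j; last by exists k; rewrite ?inE.
  exists i; first by rewrite !inE.
  by apply: lepm_trans le_ij _; rewrite -kj.
by move/minS/setP/(_ j); rewrite !inE eqxx.
Qed.

(** [f j] is divisible by a square-free generator [g l], which in turn is divisible by
    some [f i]; minimality forces [f i = g l = f j]. *)
Lemma minimal_generators_squarefree j :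
  squarefree_monomial_ideal I -> squarefree_monomial (f j).
Proof.
have [genI _] := minI; move=> [k [g [sqg genG]]].
have /(generatedX genG)[l _ le_gf] : I 'X_[f j].
  by apply/(generatedX genI); exists j; rewrite ?inE ?lepm_refl.
have /(generatedX genI)[i _ le_fg] : I 'X_[g l].
  by apply/(generatedX genG); exists l; rewrite ?inE ?lepm_refl.
have ij := minimal_generators_antichain (lepm_trans le_fg le_gf).
have <- : g l = f j by apply: mnm_le_antisym le_gf _; rewrite -ij.
exact: sqg.
Qed.

End MinimalGenerators.

(** The generator [1] would belong to a vertex that lies in no edge, whereas every
    vertex lies in a minimal edge. *)
Lemma isolated_generator_neq0 n mu (f : 'I_mu -> 'X_{1..n}) j :
  isolated_simple_edges (hypergraph_edge f) -> f j != 0%MM.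
Proof.
move=> iso; have /and3P[/eqP covM _ _] := minimal_edges_partition iso.
have : j \in cover (minimal_edges (hypergraph_edge f)) by rewrite covM inE.
case/bigcupP => F /minimal_edge_label[a ->]; rewrite inE lep1mP.
by apply: contraNneq => ->; rewrite mnm0E.
Qed.

Lemma taylor_minimal_resolution (K : fieldType) n mu (f : 'I_mu -> 'X_{1..n})
    (I : {mpoly K[n]} -> Prop) :
  generates f [set: 'I_mu] I -> (forall j, f j != 0%MM) ->
  exists F, minimal_graded_free_resolution I F.
Proof.
move=> genI f0.
have [S [a [fr amin]]] := minimal_frame_exists (@taylor_mon_origin n mu f)
  (@taylor_deg_eq0 mu) (@taylor_mon_in_ideal n mu f) f0
  (@taylor_frame K n mu f _ val_inj).
exists (frame_sequence fr); split; last exact: frame_minimal amin.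
eexists; exact: (frame_resolves (@taylor_mon_origin n mu f) (@taylor_deg_eq0 mu)
  (@taylor_mon_in_ideal n mu f) fr genI).
Qed.

Theorem theorem4p12 (K : fieldType) (n : nat) (I : {mpoly K[n]} -> Prop)
    (mu : nat) (f : 'I_mu -> 'X_{1..n}) :
  squarefree_monomial_ideal I ->
  minimal_monomial_generators I f ->
  isolated_simple_edges (hypergraph_edge f) ->
  is_regularity I
    (#|labels (hypergraph_edge f)|%:Z - #|'I_mu|%:Z
     + \sum_(F in edges (hypergraph_edge f) | simple_edge (hypergraph_edge f) F)
         (#|F|%:Z - 1)).
Proof.
move=> sqI minI iso; have [genI _] := minI.
have sqf j : squarefree_monomial (f j) := minimal_generators_squarefree minI j sqI.
rewrite (sum_simple_edges iso) addrA subrK.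
split=> [|F [[e resF] minF]].
  by apply: taylor_minimal_resolution genI _ => j; apply: isolated_generator_neq0 iso.
split=> [|_ [i [j [/eqP nz ->]]]].
  have [k kE] := top_shift sqf iso genI resF.
  exists #|minimal_edges (hypergraph_edge f)|, (shift k).
  rewrite -kE; split=> //.
  by apply/eqP; rewrite -lt0n; apply/card_gt0P; exists k; rewrite inE.
move: nz; rewrite -lt0n => /card_gt0P[k]; rewrite inE => /eqP<-.
have [eG resG] := taylor_resolves genI.
have [l ->] := minimal_shift genI k minF resF resG.
exact: taylor_shift_le.
Qed.
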